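(* Let $n\in\mathbb{P}$, $q\in\mathbb{Z}$, let $\prec_q$ be a $q$-order on $\mathbb{Z}$, let $\lambda$ be a partition and let $l\in\mathbb{N}$. Put $a(n,q)=\max(n,n-q)$ and $b(n,q)=\max(n,n+q)$. If $n<L_q(\ell(\lambda),\lambda_1)$, then $\mathrm{GOT}([n],\prec_q,\lambda,l)$ is empty. If $n\ge L_q(\ell(\lambda),\lambda_1)$, then the mapping $\Phi_q$ is a bijection from $\mathrm{GOT}([n],\prec_q,\lambda,l)$ to $\mathrm{VOS}\bigl(a(n,q),b(n,q),\alpha_{a(n,q),b(n,q),\lambda},\beta_{a(n,q),b(n,q),\lambda},l\bigr)$, and the inverse mapping is $\Theta_{(L_q,\prec_q)}$.
   Context: Notation: $\mathbb{P}$ is the set of positive integers, $\mathbb{N}$ the set of nonnegative integers, $[m,n]=\{m,m+1,\ldots,n\}$ ($=\emptyset$ if $n<m$), $[n]=[1,n]$. Osculating paths. For $a,b\in\mathbb{P}$, $[a]\times[b]$ is a rectangle of lattice points with matrix labelling ($(i,j)$ is in row $i$ from the top and column $j$ from the left). $\mathrm{BP}(a,b)$ is the set of pairs $(\alpha,\beta)$ with $\alpha\subset[a]$, $\beta\subset[b]$, $|\alpha|=|\beta|$; elements are labelled in increasing order, $\alpha=\{\alpha_1<\ldots<\alpha_r\}$, $\beta=\{\beta_1<\ldots<\beta_r\}$. For $x\in[a]$, $y\in[b]$, $\Pi(a,b,x,y)$ is the set of paths $Q=(Q_0,\ldots,Q_L)$ with $Q_0=(a,y)$, $Q_L=(x,b)$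 and each step $Q_m-Q_{m-1}\in\{(0,1),(-1,0)\}$. For $x<x'$ and $y<y'$, paths $Q\in\Pi(a,b,x,y)$ and $Q'\in\Pi(a,b,x',y')$ are osculating if whenever $Q_m=Q'_{m'}=(i,j)$, then $Q_{m-1}=(i,j-1)$, $Q_{m+1}=(i-1,j)$, $Q'_{m'-1}=(i+1,j)$ (unless $m'=0$) and $Q'_{m'+1}=(i,j+1)$ (unless $Q'_{m'}$ is the last point of $Q'$). $\mathrm{OP}(a,b,\alpha,\beta)$ is the set of $r$-tuples $P=(P_1,\ldots,P_r)$ with $P_k\in\Pi(a,b,\alpha_k,\beta_k)$ and $P_k,P_{k+1}$ osculating for each $k\in[r-1]$. A vacancy of $P$ is a point of $[a]\times[b]$ on no path of $P$; an osculation of $P$ is a point on two paths of $P$. $Z(P)$ is the set of all vacancies and osculations of $P$. $\mathrm{OP}(a,b,\alpha,\beta,l)$ is the set of $P\in\mathrm{OP}(a,b,\alpha,\beta)$ with $|Z(P)|=l$, and $\mathrm{VOS}(a,b,\alpha,\beta,l)=\{Z(P)\mid P\in\mathrm{OP}(a,b,\alpha,\beta,l)\}$. Partitions. A partition is a weakly decreasing infinite sequence $\lambda=(\lambda_1,\lambda_2,\ldots)$ of nonnegative integers with finitely many nonzero terms; $\ell(\lambda)$ is the number of nonzero terms, $|\lambda|$ the sum, $\lambda^t$ the conjugate, $Y(\lambda)=\{(i,j)\in\mathbb{P}^2\mid i\le\ell(\lambda),\,j\le\lambda_i\}$, and $\emptyset$ is the empty partition. For integers $\gamma_1>\ldots>\gamma_r\ge0$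 and $\delta_1>\ldots>\delta_r\ge0$, $(\gamma_1,\ldots,\gamma_r\,|\,\delta_1,\ldots,\delta_r)$ (Frobenius notation) is the unique partition $\lambda$ with exactly $r$ indices $i$ satisfying $\lambda_i\ge i$, and with $\lambda_i-i=\gamma_i$, $\lambda^t_i-i=\delta_i$ for $i\in[r]$. For $\lambda$ with $\ell(\lambda)\le a$ and $\lambda_1\le b$, $[a]\times[b]\setminus\lambda:=(b-\lambda_a,b-\lambda_{a-1},\ldots,b-\lambda_1)$. For $(\alpha,\beta)\in\mathrm{BP}(a,b)$, $\lambda_{a,b,\alpha,\beta}:=[a]\times[b]\setminus(b-\beta_1,\ldots,b-\beta_r\,|\,a-\alpha_1,\ldots,a-\alpha_r)$; for fixed $a,b$ this is a bijection from $\mathrm{BP}(a,b)$ to the set $\mathrm{Par}(a,b)$ of partitions with $\ell(\lambda)\le a$, $\lambda_1\le b$, whose inverse sends $\lambda$ to $(\alpha_{a,b,\lambda},\beta_{a,b,\lambda})=(\{a-\delta_1,\ldots,a-\delta_r\},\{b-\gamma_1,\ldots,b-\gamma_r\})$, where $[a]\times[b]\setminus\lambda=(\gamma_1,\ldots,\gamma_r\,|\,\delta_1,\ldots,\delta_r)$. (If $n\ge L_q(\ell(\lambda),\lambda_1)$ then $\lambda\in\mathrm{Par}(a(n,q),b(n,q))$.) Partitions $\lambda,\mu$ differ by a square, $\lambda\sim\mu$, if one of $Y(\lambda),Y(\mu)$ is the disjoint union of the other and a single point $(i,j)$; then $\Delta(\lambda,\mu):=j-i$. Oscillating tableaux. $\mathrm{OT}(\lambda,l)$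 is the set of sequences $\eta=(\eta_0=\emptyset,\eta_1,\ldots,\eta_l=\lambda)$ of partitions with $\eta_{k-1}\sim\eta_k$ for $k\in[l]$ (shape $\lambda$, length $l$). The profile of $\eta$ is $\Omega(\eta)=(\Omega(\eta)_1,\ldots,\Omega(\eta)_l)$ with $\Omega(\eta)_k=\Delta(\eta_{k-1},\eta_k)$; it determines $\eta$ uniquely. For $T\subset\mathbb{P}$ and a strict total order $\prec$ on $\mathbb{Z}$, $\mathrm{GOT}(T,\prec,\lambda,l)$ is the set of pairs $(t,\eta)\in T^l\times\mathrm{OT}(\lambda,l)$, $t=(t_1,\ldots,t_l)$, such that for each $k\in[l-1]$ either $t_k<t_{k+1}$, or $t_k=t_{k+1}$ and $\Omega(\eta)_k\prec\Omega(\eta)_{k+1}$. Ordering pairs. An ordering pair $(L,\prec)$ is a function $L:\mathbb{P}^2\to\mathbb{P}$ and a strict total order $\prec$ on $\mathbb{Z}$ such that, for all $(i,j),(i',j')\in\mathbb{P}^2$: if $L(i,j)<L(i',j')$, or $L(i,j)=L(i',j')$ and $j-i\prec j'-i'$, then $i<i'$ or $j<j'$. For $S\in\mathrm{VOS}(a,b,\alpha,\beta,l)$, the progression for $S$ induced by $(L,\prec)$ is the unique ordering $s=(s_1,\ldots,s_l)=((i_1,j_1),\ldots,(i_l,j_l))$ of $S$ such that for each $k\in[l-1]$, $L(i_k,j_k)<L(i_{k+1},j_{k+1})$, or $L(i_k,j_k)=L(i_{k+1},j_{k+1})$ and $j_k-i_k\prec j_{k+1}-i_{k+1}$. There is a unique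 oscillating tableau $\eta(s)$ of shape $\lambda_{a,b,\alpha,\beta}$ and length $l$ with profile $(j_1-i_1,\ldots,j_l-i_l)$, and $\Theta_{(L,\prec)}(S):=((L(s_1),\ldots,L(s_l)),\eta(s))$. Complete ordering pairs. For $q,i,j\in\mathbb{Z}$, $L_q(i,j)=\max(i+q,j)$ if $q\le0$ and $L_q(i,j)=\max(i,j-q)$ if $q\ge0$. A $q$-order is a strict total order $\prec_q$ on $\mathbb{Z}$ such that $z\prec_q z'$ whenever $z<z'\le q$ or $z>z'\ge q$. For any $q$-order $\prec_q$, $(L_q,\prec_q)$ is an ordering pair. For $q,u,z\in\mathbb{Z}$ define $G_q(u,z)=(u-z,u)$ if $q\le\min(0,z)$; $(u-q,u-q+z)$ if $z\le q\le0$; $(u+q-z,u+q)$ if $0\le q\le z$; $(u,u+z)$ if $q\ge\max(0,z)$. For a generalized oscillating tableau $(t,\eta)$ of length $l$, $\Phi_q(t,\eta):=\{G_q(t_1,\Omega(\eta)_1),\ldots,G_q(t_l,\Omega(\eta)_l)\}$. *)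

(* Defs.v *)
From HB Require Import structures.
From mathcomp Require Import all_boot all_order all_algebra finmap.
From mathcomp Require Import boolp classical_sets functions.

Set Implicit Arguments.
Unset Strict Implicit.
Unset Printing Implicit Defensive.

Import Order.TTheory GRing.Theory Num.Theory.

Local Open Scope ring_scope.
Local Open Scope classical_set_scope.

(* Lattice points (i, j) carry integer coordinates in matrix labelling (row i
   counted from the top, column j), so that no truncated subtraction occurs. *)
Definition lpoint : Type := (int * int)%type.

Definition content (p : lpoint) : int := p.2 - p.1.

Definition rect (a b : nat) : seq lpoint :=
  [seq (i%:Z, j%:Z) | i <- iota 1 a, j <- iota 1 b].

(* A partition is the list of its nonzero parts, in weakly decreasing order;
   the number of nonzero parts is [size]. *)
Record intpart := IntPart {
  parts :> seq nat;
  _ : sorted geq parts && (0%N \notin parts) }.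

HB.instance Definition _ := [isSub for parts].
HB.instance Definition _ := [Choice of intpart by <:].

Definition empty_part : intpart := @IntPart [::] isT.

(* Indices start at 1. *)
Definition part (la : intpart) (i : nat) : nat := nth 0%N la i.-1.

(* [conj_part la j] is the j-th part of the conjugate, for j >= 1. *)
Definition conj_part (la : intpart) (j : nat) : nat :=
  count (fun x => j <= x)%N la.

Definition young (la : intpart) : {fset lpoint} :=
  [fset p in rect (size la) (part la 1) | p.2 <= (part la `|p.1|%N)%:Z]%fset.

Definition differ_at (la mu : intpart) (p : lpoint) : Prop :=
  (p \notin young la /\ young mu = (p |` young la)%fset) \/
  (p \notin young mu /\ young la = (p |` young mu)%fset).

Definition differ (la mu : intpart) : Prop := exists p, differ_at la mu p.

(* The content of the unique point at which la and mu differ; arbitrary (0) if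
   la and mu do not differ by a square. *)
Definition Delta (la mu : intpart) : int :=
  xget 0 [set content p | p in differ_at la mu].

Definition durfee (la : intpart) : nat :=
  count (fun i => i <= part la i)%N (iota 1 (size la)).

Definition frob_arms (la : intpart) : seq nat :=
  [seq (part la i - i)%N | i <- iota 1 (durfee la)].

Definition frob_legs (la : intpart) : seq nat :=
  [seq (conj_part la i - i)%N | i <- iota 1 (durfee la)].

(* The partition (gamma | delta) in Frobenius notation. *)
Definition frobenius (gamma delta : seq nat) : intpart :=
  xget empty_part
    [set la : intpart | frob_arms la = gamma /\ frob_legs la = delta].

Lemma rect_compl_subproof (a b : nat) (la : intpart) :
  let s := [seq x <- [seq (b - part la i)%N | i <- rev (iota 1 a)] | x != 0%N] in
  sorted geq s && (0%N \notin s).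
Proof.
move=> /=; rewrite mem_filter eqxx andbT.
apply: sorted_filter; first by move=> y x z /= yx zy; exact: leq_trans zy yx.
rewrite map_rev rev_sorted sorted_map.
have geT : transitive geq by move=> y x z /= yx zy; exact: leq_trans zy yx.
have mono i j : (i <= j)%N -> (part la j <= part la i)%N.
  move=> ij; rewrite /part; case: (ltnP j.-1 (size la)) => [jla|?]; last first.
    by rewrite nth_default.
  case/andP: (valP la) => srt _.
  have geR : reflexive geq by move=> ?; exact: leqnn.
  have ij1 : (i.-1 <= j.-1)%N by rewrite -!subn1 leq_sub2r.
  exact: (sorted_leq_nth geT geR 0%N srt _ _ (leq_ltn_trans ij1 jla) jla ij1).
apply: sub_sorted (iota_sorted 1 a) => i j ij /=.
exact: leq_sub2l (mono _ _ ij).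
Qed.

(* The complement (b - la_a, ..., b - la_1) of la in the a x b rectangle, for la
   with at most a parts, all of them at most b. *)
Definition rect_compl (a b : nat) (la : intpart) : intpart :=
  IntPart (rect_compl_subproof a b la).

(* A subset alpha of {1, ..., a} or beta of {1, ..., b} is the list of its
   elements in increasing order; [alpha_of] and [beta_of] are increasing because
   Frobenius coordinates are strictly decreasing. *)
Definition lambda_of (a b : nat) (alpha beta : seq nat) : intpart :=
  rect_compl a b
    (frobenius [seq (b - y)%N | y <- beta] [seq (a - x)%N | x <- alpha]).

Definition alpha_of (a b : nat) (la : intpart) : seq nat :=
  [seq (a - d)%N | d <- frob_legs (rect_compl a b la)].

Definition beta_of (a b : nat) (la : intpart) : seq nat :=
  [seq (b - g)%N | g <- frob_arms (rect_compl a b la)].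

Definition step (p p' : lpoint) : bool :=
  (p' - p == (0, 1)) || (p' - p == (-1, 0)).

Definition is_path (a b x y : nat) (Q : seq lpoint) : bool :=
  if Q is p :: Q' then
    [&& p == (a%:Z, y%:Z), path step p Q' & last p Q' == (x%:Z, b%:Z)]
  else false.

(* Q is the upper-left path and Q' the lower-right one. *)
Definition osculating (Q Q' : seq lpoint) : Prop :=
  forall (m m' : nat) (i j : int),
    (m < size Q)%N -> (m' < size Q')%N ->
    nth 0 Q m = (i, j) -> nth 0 Q' m' = (i, j) ->
    [/\ (0 < m)%N /\ nth 0 Q m.-1 = (i, j - 1),
        (m.+1 < size Q)%N /\ nth 0 Q m.+1 = (i - 1, j),
        (0 < m')%N -> nth 0 Q' m'.-1 = (i + 1, j) &
        (m'.+1 < size Q')%N -> nth 0 Q' m'.+1 = (i, j + 1)].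

Definition OP (a b : nat) (alpha beta : seq nat) : set (seq (seq lpoint)) :=
  [set P | [/\ size P = size alpha,
    (forall k, (k < size P)%N ->
       is_path a b (nth 0%N alpha k) (nth 0%N beta k) (nth [::] P k)) &
    (forall k, (k.+1 < size P)%N ->
       osculating (nth [::] P k) (nth [::] P k.+1))]].

Definition vacancy (P : seq (seq lpoint)) (p : lpoint) : bool :=
  ~~ has (fun Q : seq lpoint => p \in Q) P.

Definition osculation (P : seq (seq lpoint)) (p : lpoint) : bool :=
  count (fun Q : seq lpoint => p \in Q) P == 2%N.

Definition vos (a b : nat) (P : seq (seq lpoint)) : {fset lpoint} :=
  [fset p in rect a b | vacancy P p || osculation P p]%fset.

Definition OPl (a b : nat) (alpha beta : seq nat) (l : nat) :
    set (seq (seq lpoint)) :=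
  [set P | OP a b alpha beta P /\ #|` vos a b P | = l].

Definition VOS (a b : nat) (alpha beta : seq nat) (l : nat) :
    set {fset lpoint} :=
  [set vos a b P | P in OPl a b alpha beta l].

Definition OT (la : intpart) (l : nat) : set (seq intpart) :=
  [set eta | [/\ size eta = l.+1,
    nth empty_part eta 0 = empty_part, nth empty_part eta l = la &
    forall k, (k < l)%N ->
      differ (nth empty_part eta k) (nth empty_part eta k.+1)]].

Definition profile (eta : seq intpart) : seq int :=
  pairmap Delta (head empty_part eta) (behead eta).

Definition lex_prec (prec : rel int) (x y : int * int) : bool :=
  (x.1 < y.1) || ((x.1 == y.1) && prec x.2 y.2).

Definition GOT (T : set int) (prec : rel int) (la : intpart) (l : nat) :
    set (seq int * seq intpart) :=
  [set te | [/\ size te.1 = l, (forall u, u \in te.1 -> T u), OT la l te.2 &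
    sorted (lex_prec prec) (zip te.1 (profile te.2))]].

Definition is_progression (L : lpoint -> int) (prec : rel int)
    (S : {fset lpoint}) (s : seq lpoint) : Prop :=
  [/\ uniq s, s =i S &
      sorted (lex_prec prec) [seq (L p, content p) | p <- s]].

(* The unique progression, and below the unique oscillating tableau with the
   given shape and profile, are obtained by definite description. *)
Definition progression (L : lpoint -> int) (prec : rel int)
    (S : {fset lpoint}) : seq lpoint :=
  xget [::] (is_progression L prec S).

Definition tableau (la : intpart) (w : seq int) : seq intpart :=
  xget [::] [set eta | OT la (size w) eta /\ profile eta = w].

(* Theta depends on the a, b, alpha, beta for which S is in VOS, through the
   shape of the tableau. *)
Definition Theta (L : lpoint -> int) (prec : rel int)
    (a b : nat) (alpha beta : seq nat) (S : {fset lpoint}) :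
    seq int * seq intpart :=
  let s := progression L prec S in
  ([seq L p | p <- s],
   tableau (lambda_of a b alpha beta) [seq content p | p <- s]).

Definition strict_total_order (prec : rel int) : Prop :=
  [/\ irreflexive prec, transitive prec &
      forall z z', z != z' -> prec z z' || prec z' z].

Definition q_order (q : int) (prec : rel int) : Prop :=
  [/\ strict_total_order prec,
      (forall z z', z < z' -> z' <= q -> prec z z') &
      (forall z z', z > z' -> z' >= q -> prec z z')].

(* In [Lq] and [Gq] the defining cases overlap, and agree where they do. *)
Definition Lq (q : int) (p : lpoint) : int :=
  if q <= 0 then Num.max (p.1 + q) p.2 else Num.max p.1 (p.2 - q).

Definition Gq (q u z : int) : lpoint :=
  if q <= Num.min 0 z then (u - z, u)
  else if z <= q <= 0 then (u - q, u - q + z)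
  else if 0 <= q <= z then (u + q - z, u + q)
  else (u, u + z).

Definition Phi (q : int) (te : seq int * seq intpart) : {fset lpoint} :=
  [fset p in [seq Gq q uz.1 uz.2 | uz <- zip te.1 (profile te.2)]]%fset.

Definition pos_upto (n : nat) : set int := [set u | 1 <= u <= n%:Z].

(* The maxima are positive for n > 0, so [absz] only changes the type. *)
Definition dim_a (n : nat) (q : int) : nat := `|(Num.max n%:Z (n%:Z - q))%R|%N.
Definition dim_b (n : nat) (q : int) : nat := `|(Num.max n%:Z (n%:Z + q))%R|%N.

(* Main.v *)
(* Encode a partition by its Maya diagram, a 0/1 word on Z with letter 1 at
   position p iff p = lambda_i - i + 1 for some i >= 1. Adding or removing a square
   of content z exchanges two distinct letters at z and z + 1. For osculating
   paths, read along a frontier of the rectangle the vertical edges (used = 1)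
   and the horizontal edges (used = 0). Passing a point (i, j) leaves the word
   unchanged unless the point is a vacancy or an osculation, in which case
   the distinct letters at j - i and j - i + 1 are exchanged. Starting from the
   top and left sides, the word of the empty partition, one ends at the word of
   lambda on the bottom and right sides. Points that are incomparable in the
   product order have contents at distance at least 2, so their exchanges
   commute and any linear extension of that order can be used to visit the
   points, in particular the progression of an ordering pair. *)
Require Import Defs.
From mathcomp Require Import all_boot all_order all_algebra finmap zify.
From mathcomp Require Import boolp classical_sets functions.

Set Implicit Arguments.
Unset Strict Implicit.
Unset Printing Implicit Defensive.

Import Order.TTheory GRing.Theory Num.Theory.

Local Open Scope ring_scope.
Local Open Scope classical_set_scope.

(** * Exchanges of adjacent letters in words *)

(** Both sides of the bijection reduce to the same data: sequences of swaps of distinct letters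
    leading from [word0] to [maya la]. For tableaux this works because any swap of distinct letters
    in a Maya word gives the word of a partition. For vacancy-osculation sets the paths must be
    rebuilt from a bare point set; this goes by induction on the number of rows, removing the bottom
    one, where osculation becomes interlacing of the starting columns before and after the removal.
    [Phi] only changes coordinates, from (L_q, content) to (i, j). The real obstacle is that its
    points lie in the rectangle, since the definition of [GOT] puts no bound on the contents. The
    q-order supplies the bound: a level set of L_q is a hook whose corner has content q, visited
    from both ends towards the corner, so a content beyond an end of the hook would either swap
    equal letters or come too late in the order. The same bound keeps all swaps inside the window of
    the rectangle, whence the emptiness for a large lambda. *)

Definition word0 : int -> bool := fun p => p <= 0.

Definition swapw (z : int) (w : int -> bool) : int -> bool :=
  fun p => if p == z then w (z + 1) else if p == z + 1 then w z else w p.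

Fixpoint valid (w : int -> bool) (zs : seq int) : bool :=
  if zs is z :: zs' then (w z != w (z + 1)) && valid (swapw z w) zs' else true.

Definition run (w : int -> bool) (zs : seq int) : int -> bool :=
  foldl (fun w z => swapw z w) w zs.

Lemma valid_cat w s1 s2 : valid w (s1 ++ s2) = valid w s1 && valid (run w s1) s2.
Proof. by elim: s1 w => //= z s1 IH w; rewrite IH andbA. Qed.

Lemma run_cat w s1 s2 : run w (s1 ++ s2) = run (run w s1) s2.
Proof. exact: foldl_cat. Qed.

Lemma run_out w zs p : (forall z, z \in zs -> (p != z) && (p != z + 1)) ->
  run w zs p = w p.
Proof.
elim: zs w => //= z zs IH w out.
rewrite IH; last by move=> y yzs; apply: out; rewrite inE yzs orbT.
have /andP[/negPf pz /negPf pz1] := out z (mem_head _ _).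
by rewrite /swapw pz pz1.
Qed.

(** A swap of distinct letters changes the word exactly at [z] and [z + 1], so [z] can be recovered.
    Through [Delta_content] this frees [Delta] from the choice made by [xget]. *)
Lemma swapw_inj w z y : w z != w (z + 1) -> w y != w (y + 1) ->
  swapw z w = swapw y w -> z = y.
Proof.
move=> wz wy /(congr1 (fun f => (f z, f y, f (z + 1), f (y + 1)))).
rewrite /swapw !eqxx => -[].
case: (eqVneq z y) => // zy; case: (eqVneq (z + 1) y) => [<-|zy1].
  rewrite (_ : (z == z + 1 + 1) = false); last by lia.
  by move=> /esym e; rewrite e eqxx in wz.
rewrite (_ : (z + 1 == z) = false); last by lia.
rewrite (_ : (y + 1 == y) = false); last by lia.
case: eqP => [zy2 _ _ |_ e]; last by rewrite e eqxx in wz.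
rewrite (_ : (z + 1 == y + 1) = false); last by lia.
by move=> e; rewrite e eqxx in wz.
Qed.

Lemma swapwC w z y : 1 < `|z - y| -> swapw z (swapw y w) = swapw y (swapw z w).
Proof.
move=> far; apply/funext => p; rewrite /swapw.
have [->|pz] := eqVneq p z.
  by rewrite !ifN_eq //; lia.
have [->|pz1] := eqVneq p (z + 1); first by rewrite !ifN_eq //; lia.
have [_|py] := eqVneq p y; first by rewrite !ifN_eq //; lia.
have [//|//] := eqVneq p (y + 1); first by rewrite !ifN_eq //; lia.
Qed.

Lemma swapw_far w z y : 1 < `|z - y| ->
  (swapw y w z = w z) * (swapw y w (z + 1) = w (z + 1)).
Proof. by move=> far; rewrite /swapw !ifN_eq //; lia. Qed.

Lemma run_pull w z zs : (forall y, y \in zs -> 1 < `|z - y|) ->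
  (valid w (rcons zs z) = valid w (z :: zs)) *
  (run w (rcons zs z) = run w (z :: zs)).
Proof.
elim: zs w => [|y zs IH] w far; first by [].
have farz : 1 < `|z - y| by apply: far; rewrite mem_head.
have fary : 1 < `|y - z| by lia.
have {}IH := IH _ (fun x xzs => far x (mem_behead (s := y :: zs) xzs)).
rewrite /= (IH (swapw y w)).1 [run _ _](IH (swapw y w)).2 /=.
rewrite !(swapw_far _ farz) !(swapw_far _ fary) (swapwC _ farz).
by split=> //; rewrite andbCA.
Qed.

(** This is the negation of p' <= p in the product order. It is not transitive, so linear extensions
    are expressed with [pairwise] and not with [sorted]. *)
Definition before (p p' : lpoint) : bool := (p.1 < p'.1) || (p.2 < p'.2).

(* Incomparable points have contents at distance at least 2, and the
   corresponding swaps commute. *)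
Lemma linear_extension w (s1 s2 : seq lpoint) :
  perm_eq s1 s2 -> pairwise before s1 -> pairwise before s2 ->
  (valid w [seq content p | p <- s1] = valid w [seq content p | p <- s2]) *
  (run w [seq content p | p <- s1] = run w [seq content p | p <- s2]).
Proof.
elim: s1 s2 w => [|x s1 IH] s2 w.
  by move=> /perm_size /esym/size0nil ->.
move=> eq12 /= /andP[/allP x_s1 pw1].
have xs2 : x \in s2 by rewrite -(perm_mem eq12) mem_head.
case/splitPr: s2 / xs2 eq12 => A B eq12.
have {}eq12 : perm_eq s1 (A ++ B).
  by rewrite -(perm_cons x) (permPl eq12) perm_catC /= perm_cons perm_catC.
rewrite pairwise_cat /= => /and4P[/allrelP AxB pwA _ pwB].
have {AxB} [Ax AB] : (forall y, y \in A -> before y x) /\ allrel before A B.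
  split=> [y yA|]; first by apply: AxB => //; exact: mem_head.
  by apply/allrelP => y z yA zB; apply: AxB => //; rewrite inE zB orbT.
(* A point of [A] precedes [x] in [s2] and follows it in [s1]; the two instances of [before] then
   move the two coordinates in opposite directions. *)
have far : forall z, z \in [seq content p | p <- A] -> 1 < `|content x - z|.
  move=> _ /mapP[y yA ->]; have := Ax _ yA.
  have := x_s1 y; rewrite (perm_mem eq12) mem_cat yA => /(_ isT).
  by rewrite /before /content; lia.
have pwAB : pairwise before (A ++ B) by rewrite pairwise_cat AB pwA.
have := IH _ (swapw (content x) w) eq12 pw1 pwAB.
rewrite !map_cat !valid_cat !run_cat /= => -[-> ->].
have [] := run_pull w far.
rewrite -cats1 valid_cat run_cat /= andbT => v ->.
by split=> //; rewrite andbA -v -andbA.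
Qed.

(** * Adding a row to osculating paths *)

Definition seg (i y c : nat) : seq lpoint :=
  [seq (i%:Z, j%:Z) | j <- iota y (c.+1 - y)].

Lemma mem_seg i y c (p : lpoint) :
  (p \in seg i y c) = (p.1 == i%:Z) && (y%:Z <= p.2 <= c%:Z).
Proof.
case: p => p1 p2 /=; apply/mapP/idP => [[j]|/andP[/eqP -> yc]].
  by rewrite mem_iota => jyc [-> ->]; lia.
by exists `|p2|%N; [rewrite mem_iota|congr (_, _)]; lia.
Qed.

Lemma size_seg i y c : size (seg i y c) = (c.+1 - y)%N.
Proof. by rewrite size_map size_iota. Qed.

Lemma nth_seg i y c m : (m < c.+1 - y)%N ->
  nth 0 (seg i y c) m = (i%:Z, (y + m)%N%:Z).
Proof. by move=> mc; rewrite (nth_map 0%N) ?size_iota ?nth_iota. Qed.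

Lemma seg_cons i y c : (y <= c)%N ->
  seg i y c = (i%:Z, y%:Z) :: seg i y.+1 c.
Proof. by move=> yc; rewrite /seg subSn // subSS. Qed.

Lemma seg_nil i c : seg i c.+1 c = [::].
Proof. by rewrite /seg subnn. Qed.

Lemma stepE (p p' : lpoint) : step p p' =
  ((p'.1 == p.1) && (p'.2 == p.2 + 1)) || ((p'.1 == p.1 - 1) && (p'.2 == p.2)).
Proof.
case: p p' => [p1 p2] [q1 q2].
rewrite /step (_ : (q1, q2) - (p1, p2) = (q1 - p1, q2 - p2)) // !xpair_eqE /=.
by lia.
Qed.

Lemma path_monotone (p : lpoint) Q : path step p Q ->
  forall q : lpoint, q \in p :: Q -> (q.1 <= p.1) && (p.2 <= q.2).
Proof.
elim: Q p => [|p' Q IH] p /=; first by move=> _ q; rewrite inE => /eqP ->; lia.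
rewrite stepE => /andP[pp' /IH{}IH] q; rewrite inE => /predU1P[->|/IH]; lia.
Qed.

(** A path never goes down, so its points in row [a.+1] form an initial segment, and the column
    where it leaves that row is the starting column of the rest. A path that ends in row [a.+1] gets
    the pair (b, [::]), in accordance with the defaults of [nth] in [add_row]. *)
Lemma is_path_split a b x y Q : is_path a.+1 b x y Q -> (x <= a.+1)%N ->
  exists cQ : nat * seq lpoint,
    [/\ (y <= cQ.1 <= b)%N, Q = seg a.+1 y cQ.1 ++ cQ.2,
        (x <= a)%N -> is_path a b x cQ.1 cQ.2 &
        x = a.+1 -> cQ = (b, [::])].
Proof.
case: Q => // p Q /and3P[/eqP -> {p}].
elim: Q y => [|p Q IH] y /=.
  move=> _ /eqP[<- <-] _; exists (y, [::]); rewrite seg_cons // seg_nil /=.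
  by split=> //; lia.
rewrite stepE => /andP[/= stp pQ] lst xa.
have lstin := path_monotone pQ (mem_last p Q).
rewrite (eqP lst) /= in lstin.
case/orP: stp => /andP[/eqP p1 /eqP p2].
  have pE : p = (a.+1%:Z, y.+1%:Z).
    by rewrite [p]surjective_pairing p1 p2; congr (_, _); lia.
  rewrite {p p1 p2 lstin}pE in pQ lst *.
  have [[c Q1] /= [yc QE pth ended]] := IH _ pQ lst xa.
  exists (c, Q1); split=> //=; first by lia.
  by rewrite seg_cons; [rewrite QE|lia].
have pE : p = (a%:Z, y%:Z).
  by rewrite [p]surjective_pairing p1 p2; congr (_, _); lia.
exists (y, p :: Q); rewrite seg_cons // seg_nil /=; split=> //; first by lia.
  by rewrite pQ lst {1}pE eqxx.
by lia.
Qed.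

Lemma is_path_cat a b x y c Q : (y <= c)%N -> is_path a b x c Q ->
  is_path a.+1 b x y (seg a.+1 y c ++ Q).
Proof.
case: Q => // p Q yc /and3P[/eqP -> {p}] pQ lst.
(* Induction on the length: the segment grows leftwards from its fixed right end [c]. *)
have -> : y = (c - (c - y))%N by lia.
elim: (c - y)%N {yc} => [|n IH].
  rewrite subn0 seg_cons // seg_nil /= eqxx pQ lst !andbT.
  by rewrite stepE /=; lia.
have [nc|cn] := ltnP n c; last by rewrite (_ : (c - n.+1 = c - n)%N) //; lia.
have -> : (c - n.+1 = (c - n).-1)%N by lia.
move: IH; set y' := (c - n)%N => IH; rewrite seg_cons; last by lia.
rewrite (_ : y'.-1.+1 = y'); last by lia.
have y'c : (y' <= c)%N by lia.
move: IH; rewrite (seg_cons _ y'c) /= eqxx /= stepE /= => /andP[-> ->].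
by rewrite !andbT eqxx /=; lia.
Qed.

Lemma is_path_seg a b y : (y <= b)%N -> is_path a b a y (seg a y b).
Proof.
move=> yb; have -> : y = (b - (b - y))%N by lia.
elim: (b - y)%N {yb} => [|n IH].
  by rewrite subn0 seg_cons // seg_nil /= !eqxx.
have [nb|bn] := ltnP n b; last by rewrite (_ : (b - n.+1 = b - n)%N) //; lia.
have -> : (b - n.+1 = (b - n).-1)%N by lia.
move: IH; set y' := (b - n)%N => IH; rewrite seg_cons; last by lia.
rewrite (_ : y'.-1.+1 = y'); last by lia.
have y'b : (y' <= b)%N by lia.
move: IH; rewrite (seg_cons _ y'b) /= eqxx /= stepE /= => /andP[-> ->].
by rewrite !andbT eqxx /=; lia.
Qed.

Definition starts_at (a c : nat) (Q : seq lpoint) : Prop :=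
  (forall p, p \in Q -> p.1 <= a%:Z) /\
  ((0 < size Q)%N -> nth 0 Q 0 = (a%:Z, c%:Z)).

Lemma is_path_starts_at a b x c Q : is_path a b x c Q ->
  starts_at a c Q /\ (0 < size Q)%N.
Proof.
case: Q => // p Q /and3P[/eqP -> {p} pQ _]; split=> //; split=> // q qQ.
by have /andP[] := path_monotone pQ qQ.
Qed.

(** At a common point the upper-left path leaves upwards and the lower-right one to the right, so
    the bottom segments can share only the point c = y', and there the second path may not turn up
    at once, whence c < c'. Higher up, the exemption for the first point of [Q'] is consistent,
    because in the concatenation its predecessor lies directly below it. *)
Lemma osculating_cat a y c y' c' Q Q' :
  (y <= c)%N -> (y' <= c')%N -> (y < y')%N ->
  starts_at a c Q -> starts_at a c' Q' -> (0 < size Q)%N ->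
  osculating (seg a.+1 y c ++ Q) (seg a.+1 y' c' ++ Q') <->
  [/\ (c <= y')%N, (0 < size Q')%N -> (c < c')%N & osculating Q Q'].
Proof.
move=> yc yc' yy' [Qa Q0] [Qa' Q0'] Qgt0.
have nthE i z d R m : (z <= d)%N -> nth 0 (seg i z d ++ R) m =
    if (m <= d - z)%N then (i%:Z, (z + m)%N%:Z) else nth 0 R (m - (d.+1 - z)).
  move=> zd; rewrite nth_cat size_seg (_ : (m < d.+1 - z)%N = (m <= d - z)%N).
    by case: ifP => // md; rewrite nth_seg //; lia.
  by lia.
split=> [osc|[cy' cc' osc] m m' i j].
  have cy' : (c <= y')%N.
    rewrite leqNgt; apply/negP => y'c.
    have := osc (y' - y)%N 0%N a.+1%:Z y'%:Z.
    rewrite !size_cat !size_seg !nthE // !leq0n ![if (_ <= c - y)%N then _ else _]ifT; [|lia..].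
    by case; [lia|lia|congr (_, _); lia|congr (_, _); lia|move=> _ [_] []; lia].
  split=> //.
    move=> Q'gt0; have [cy|] := ltnP c y'; first by lia.
    move=> y'c; have cE : c = y' by lia.
    have := osc (c - y)%N 0%N a.+1%:Z y'%:Z.
    rewrite !size_cat !size_seg !nthE // !leq0n.
    case; [lia|lia|by rewrite ifT; [congr (_, _)|]; lia|congr (_, _); lia|move=> _ _ _].
    case: ifP; first by lia.
    move=> y'c' next; have /next : (1 < c'.+1 - y' + size Q')%N by lia.
    rewrite (_ : (1 - (c'.+1 - y') = 0)%N); last by lia.
    by rewrite Q0' // => -[]; lia.
  move=> m m' i j mQ mQ' Qm Qm'.
  have := osc (m + (c.+1 - y))%N (m' + (c'.+1 - y'))%N i j.
  rewrite !size_cat !size_seg !nthE //.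
  rewrite (_ : (m + (c.+1 - y) <= c - y)%N = false); last by lia.
  rewrite (_ : ((m + (c.+1 - y)).+1 <= c - y)%N = false); last by lia.
  rewrite (_ : (m' + (c'.+1 - y') <= c' - y')%N = false); last by lia.
  rewrite (_ : ((m' + (c'.+1 - y')).+1 <= c' - y')%N = false); last by lia.
  rewrite -!addSn !addnK => /(_ _ _ Qm Qm') [||[_ prevQ] [ltQ nextQ] prevQ' nextQ'].
  - by lia.
  - by lia.
  (* The first point of [Q] is entered from below, whereas an osculation requires this path to come
     from the left. *)
  have m_gt0 : (0 < m)%N.
    rewrite lt0n; apply/eqP => m0; move: prevQ.
    rewrite m0 Q0 // in Qm; case: Qm => <- _.
    by rewrite m0 ifT; [move=> []; lia|lia].
  split.
  - split=> //; move: prevQ; rewrite ifF; last by lia.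
    by rewrite (_ : (_ - _ = m.-1)%N) //; lia.
  - by split=> //; lia.
  - move=> m'_gt0; move: prevQ'; rewrite ifF; last by lia.
    by rewrite (_ : (_.-1 - _ = m'.-1)%N); [apply; lia|lia].
  - by move=> m'_lt; apply: nextQ'; lia.
rewrite !size_cat !size_seg => mQ mQ'; rewrite !nthE //.
case: (leqP m (c - y)) => mc; case: (leqP m' (c' - y')) => mc'.
- move=> [<- <-] [yy]; have [-> m'0] : m = (c - y)%N /\ m' = 0%N by lia.
  rewrite m'0; split.
  + split; first by lia.
    by rewrite ifT; [congr (_, _)|]; lia.
  + split; first by lia.
    rewrite ifF; last by lia.
    rewrite (_ : ((c - y).+1 - (c.+1 - y) = 0)%N); last by lia.
    by rewrite Q0 //; congr (_, _); lia.
  + by [].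
  + have [Q'gt0 _|Q'0 lt1] := ltnP 0 (size Q').
      by have := cc' Q'gt0 => ?; rewrite ifT; [congr (_, _)|]; lia.
    by rewrite ifT; [congr (_, _)|]; lia.
- move=> [<- _] Q'm'; have mm' : (m' - (c'.+1 - y') < size Q')%N by lia.
  by have := Qa' _ (mem_nth 0 mm'); rewrite Q'm' /=; lia.
- move=> Qm [iE _]; have mm : (m - (c.+1 - y) < size Q)%N by lia.
  by have := Qa _ (mem_nth 0 mm); rewrite Qm /=; lia.
move=> Qm Q'm'; have [] := osc _ _ _ _ _ _ Qm Q'm'; [by lia..|].
move=> [m_gt0 prevQ] [mltQ nextQ] prevQ' nextQ'; split.
- split; first by lia.
  rewrite ifF; last by lia.
  by rewrite (_ : (m.-1 - (c.+1 - y) = (m - (c.+1 - y)).-1)%N) //; lia.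
- split; first by lia.
  rewrite ifF; last by lia.
  by rewrite (_ : (m.+1 - (c.+1 - y) = (m - (c.+1 - y)).+1)%N) //; lia.
- move=> _; have [m'0|m'gt] := posnP (m' - (c'.+1 - y'))%N.
    move: Q'm'; rewrite m'0 Q0'; last by lia.
    by move=> -[<- <-]; rewrite ifT; [congr (_, _)|]; lia.
  rewrite ifF; last by lia.
  by rewrite (_ : (m'.-1 - (c'.+1 - y') = (m' - (c'.+1 - y')).-1)%N); [exact: prevQ'|lia].
- move=> lt; rewrite ifF; last by lia.
  rewrite (_ : (m'.+1 - (c'.+1 - y') = (m' - (c'.+1 - y')).+1)%N); last by lia.
  by apply: nextQ'; lia.
Qed.

Lemma nth_ltn_count d (s : seq nat) k j : sorted ltn s -> (k < size s)%N ->
  (nth d s k < j)%N = (k < count (fun x => x < j) s)%N.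
Proof.
elim: s k => // x s IH k /= xs ks.
have [xj|jx] := ltnP x j; first by case: k ks => // k ks; rewrite /= IH // (path_sorted xs).
have /allP xs' := order_path_min ltn_trans xs.
have s0 : count (fun y => y < j)%N s = 0%N.
  by apply/eqP; rewrite -leqn0 leqNgt -has_count; apply/hasPn => y /xs' /=; lia.
rewrite s0 ltn0; case: k ks => /= [_|k ks]; first by lia.
by have /= := xs' _ (mem_nth d ks); lia.
Qed.

(** This is be_1 <= c_1 <= be_2 <= c_2 <= ... in counting form. The difference of the two counts at
    a column j of the rectangle is the number, 0 or 1, of paths that cross from column j - 1 to
    column j in the added row. *)
Definition interlace (be c : seq nat) : Prop := forall j,
  (count (fun x => x < j) c <= count (fun x => x < j) be
     <= (count (fun x => x < j) c).+1)%N.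

Lemma interlaceP b (be c : seq nat) :
  sorted ltn be -> sorted ltn c ->
  all (fun j => j <= b)%N be -> all (fun j => j <= b)%N c ->
  interlace be c <->
  [/\ (size c <= size be <= (size c).+1)%N,
      forall k, (k < size c)%N -> (nth 0 be k <= nth b c k)%N &
      forall k, (k.+1 < size be)%N -> (nth b c k <= nth 0 be k.+1)%N].
Proof.
move=> sbe sc /allP leb /allP lec; split=> [il|[/andP[sz1 sz2] il1 il2] j].
  have sz : (size c <= size be <= (size c).+1)%N.
    have cnt s : {in s, forall j, (j <= b)%N} ->
        count (fun x => x < b.+1)%N s = size s.
      by move=> lt; apply/eqP; rewrite -all_count; apply/allP => x /lt; lia.
    by rewrite -(cnt _ leb) -(cnt _ lec).
  (* A violation at [k] is detected by the counts at j = c_k + 1 for the first inequality and at j =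
     c_k for the second. *)
  split=> // k kc; rewrite leqNgt; apply/negP.
    have kb : (k < size be)%N by lia.
    move=> lt; have := il (nth b c k).+1.
    have := nth_ltn_count b (nth b c k).+1 sc kc.
    have := nth_ltn_count 0 (nth b c k).+1 sbe kb.
    by rewrite ltnSn; lia.
  have kc' : (k < size c)%N by lia.
  move=> lt; have := il (nth b c k).
  have := nth_ltn_count b (nth b c k) sc kc'.
  have := nth_ltn_count 0 (nth b c k) sbe kc.
  by rewrite ltnn; lia.
have cc : (count (fun x => x < j) c <= size c)%N by exact: count_size.
have cb : (count (fun x => x < j) be <= size be)%N by exact: count_size.
apply/andP; split.
  case E : (count _ c) => [//|k].
  have kc : (k < size c)%N by lia.
  have kb : (k < size be)%N by lia.
  have := il1 _ kc; have := nth_ltn_count b j sc kc.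
  by have := nth_ltn_count 0 j sbe kb; rewrite E; lia.
case E : (count _ be) => [//|[//|k]].
have kb : (k.+1 < size be)%N by lia.
have kc : (k < size c)%N by lia.
have := il2 _ kb; have := nth_ltn_count b j sc kc.
by have := nth_ltn_count 0 j sbe kb; rewrite E; lia.
Qed.

(** The maximal value can only be the last entry: at most one path, the last, ends in the bottom
    row. *)
Lemma sorted_split_max a (al : seq nat) :
  sorted ltn al -> all (fun x => x <= a.+1)%N al ->
  al = [seq x <- al | x <= a]%N ++ nseq (a.+1 \in al) a.+1.
Proof.
elim: al => // x al IH /= xal /andP[xa ala].
have {}IH := IH (path_sorted xal) ala; rewrite inE.
have [xa1|ax] := leqP x a.
  by rewrite (_ : a.+1 == x = false) /= -?IH //; lia.
have xE : x = a.+1 by lia.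
have /allP min := order_path_min ltn_trans xal.
case: al {IH xal} ala min => [|y al] /=; first by rewrite xE eqxx.
by move=> /andP[ya _] /(_ y (mem_head _ _)) /=; lia.
Qed.

(* The k-th path occupies columns [be_k, c_k] of the added row a+1; a path that
   ends in that row has no entry in [c], and the default b of [nth]. *)
Definition add_row (a b : nat) (be c : seq nat) (P : seq (seq lpoint)) :
    seq (seq lpoint) :=
  mkseq (fun k => seg a.+1 (nth 0%N be k) (nth b c k) ++ nth [::] P k) (size be).

Definition cols (b : nat) (s : seq nat) : bool :=
  sorted ltn s && all (fun j => 1 <= j <= b)%N s.

Lemma cols_nth b s d k : cols b s -> (k < size s)%N ->
  (1 <= nth d s k <= b)%N.
Proof. by case/andP=> _ /allP rng ks; apply: rng; rewrite mem_nth. Qed.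

Lemma cols_le b s : cols b s -> all (fun j => j <= b)%N s.
Proof. by case/andP=> _; apply: sub_all => j /andP[]. Qed.

Lemma cols_filter a s : cols a.+1 s -> cols a [seq x <- s | (x <= a)%N].
Proof.
case/andP=> srt /allP rng; apply/andP; split.
  by apply: sorted_filter => //; exact: ltn_trans.
apply/allP => x; rewrite mem_filter => /andP[xa /rng]; lia.
Qed.

Lemma nth_filter_le a s d k : cols a.+1 s ->
  (k < size [seq x <- s | x <= a]%N)%N ->
  nth d s k = nth d [seq x <- s | x <= a]%N k.
Proof.
move=> cs kl; case/andP: (cs) => srt _.
by rewrite {1}(sorted_split_max srt (cols_le cs)) nth_cat kl.
Qed.

Lemma nth_filter_gt a s d k : cols a.+1 s ->
  (size [seq x <- s | x <= a]%N <= k < size s)%N ->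
  k = size [seq x <- s | x <= a]%N /\ nth d s k = a.+1.
Proof.
case/andP=> srt /allP rng; have := sorted_split_max srt.
have /[swap]/[apply] : all (fun x => x <= a.+1)%N s.
  by apply/allP => x /rng /andP[].
move: [seq x <- s | x <= a]%N (a.+1 \in s) => s1 B -> /andP[s1k].
rewrite size_cat size_nseq => ks; rewrite nth_cat ltnNge s1k /=.
case: B ks => /= ks; last by lia.
by have -> : k = size s1 by [lia]; rewrite subnn.
Qed.

(** Every path is cut where it leaves row [a.+1]. By [osculating_cat], consecutive cuts satisfy c_k
    <= be_(k+1) and c_k < c_(k+1), so the cuts interlace with [be] and are legitimate starting
    columns in the smaller rectangle. *)
Lemma OP_row_split a b al be P :
  cols a.+1 al -> cols b be -> size al = size be -> OP a.+1 b al be P ->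
  exists c P1, [/\ cols b c, size c = size [seq x <- al | x <= a]%N,
    interlace be c, P = add_row a b be c P1 &
    OP a b [seq x <- al | x <= a]%N c P1].
Proof.
set al1 := filter _ _ => Cal Cbe sz [szP pathP oscP].
have szal1 : (size al1 <= size al <= (size al1).+1)%N.
  case/andP: (Cal) => srt _.
  rewrite (sorted_split_max srt (cols_le Cal)) size_cat size_nseq -/al1.
  by case: (_ \in _) => /=; lia.
have split_ex : forall k, exists cQ : nat * seq lpoint, (k < size P)%N ->
    [/\ (nth 0 be k <= cQ.1 <= b)%N,
        nth [::] P k = seg a.+1 (nth 0%N be k) cQ.1 ++ cQ.2,
        (nth 0 al k <= a)%N -> is_path a b (nth 0%N al k) cQ.1 cQ.2 &
        nth 0%N al k = a.+1 -> cQ = (b, [::])].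
  move=> k; have [kP|Pk] := ltnP k (size P); last by exists (0%N, [::]).
  have [|cQ] := is_path_split (pathP _ kP); last by exists cQ.
  by have := cols_nth 0 Cal (_ : k < size al)%N; rewrite -szP => /(_ kP); lia.
case/choice: split_ex => f fP.
pose c := mkseq (fun k => (f k).1) (size al1).
pose P1 := mkseq (fun k => (f k).2) (size al1).
have szc : size c = size al1 by rewrite size_mkseq.
have szP1 : size P1 = size al1 by rewrite size_mkseq.
(* The only index beyond the end of [c] is that of a path ending in row [a.+1]; its cut (b, [::])
   agrees with the default values. *)
have cE k : (k < size P)%N -> nth b c k = (f k).1.
  move=> kP; have [kl|lk] := ltnP k (size al1); first by rewrite nth_mkseq.
  rewrite nth_default ?szc //; have [_ _ _ ->] // := fP _ kP.
  by apply: (@nth_filter_gt a al 0%N k Cal _).2; rewrite lk -szP.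
have QE k : (k < size P)%N -> nth [::] P1 k = (f k).2.
  move=> kP; have [kl|lk] := ltnP k (size al1); first by rewrite nth_mkseq.
  rewrite nth_default ?szP1 //; have [_ _ _ ->] // := fP _ kP.
  by apply: (@nth_filter_gt a al 0%N k Cal _).2; rewrite lk -szP.
have PE k : (k < size P)%N ->
    nth [::] P k = seg a.+1 (nth 0%N be k) (nth b c k) ++ nth [::] P1 k.
  by move=> kP; rewrite cE // QE //; have [] := fP _ kP.
have be_c k : (k < size P)%N -> (nth 0 be k <= nth b c k <= b)%N.
  by move=> kP; rewrite cE //; have [] := fP _ kP.
have pth k : (k < size al1)%N ->
    is_path a b (nth 0%N al1 k) (nth 0%N c k) (nth [::] P1 k).
  move=> kl; have kP : (k < size P)%N by lia.
  rewrite [nth 0%N c k](set_nth_default b) ?szc // cE // QE // -nth_filter_le //.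
  have [_ _ pth _] := fP _ kP; apply: pth.
  by rewrite (nth_filter_le _ Cal) //; have := cols_nth 0 (cols_filter Cal) kl; lia.
have sbe := proj1 (andP Cbe).
have osc k : (k.+1 < size P)%N ->
    [/\ (nth b c k <= nth 0 be k.+1)%N,
        (k.+1 < size al1)%N -> (nth b c k < nth b c k.+1)%N &
        osculating (nth [::] P1 k) (nth [::] P1 k.+1)].
  move=> kP; have kP' := ltnW kP; have kl : (k < size al1)%N by lia.
  have := oscP _ kP; rewrite !PE //.
  have [st gt0] := is_path_starts_at (pth _ kl).
  rewrite (set_nth_default b) ?szc // in st.
  have st' : starts_at a (nth b c k.+1) (nth [::] P1 k.+1) /\
      ((k.+1 < size al1)%N -> (0 < size (nth [::] P1 k.+1))%N).
    have [kl'|lk'] := ltnP k.+1 (size al1).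
      have := is_path_starts_at (pth _ kl').
      by rewrite (set_nth_default b) ?szc // => -[].
    by rewrite [nth [::] P1 _]nth_default ?szP1.
  rewrite osculating_cat //.
  - by case=> ? lt ?; split=> // kl'; apply: lt; exact: st'.2.
  - by have := be_c _ kP'; lia.
  - by have := be_c _ kP; lia.
  - by apply: (sorted_ltn_nth ltn_trans 0%N sbe) => //; rewrite inE; lia.
  - exact: st'.1.
exists c, P1; split=> //.
- apply/andP; split.
    apply/(sortedP b) => k; rewrite szc => kl.
    by have [|_ lt _] := osc k; [lia|exact: lt].
  apply/(all_nthP b) => k; rewrite szc => kl.
  have kP : (k < size P)%N by lia.
  by have := be_c _ kP; have := cols_nth 0 Cbe (_ : k < size be)%N; lia.
- apply/(interlaceP (b := b)) => //.
  + apply/(sortedP b) => k; rewrite szc => kl.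
    by have [|_ lt _] := osc k; [lia|exact: lt].
  + exact: cols_le Cbe.
  + apply/(all_nthP b) => k; rewrite szc => kl.
    by have := be_c k; lia.
  + split; rewrite ?szc -?sz // => k kl; first by have := be_c k; lia.
    by have [|] := osc k; lia.
- apply: (@eq_from_nth _ [::]); first by rewrite size_mkseq szP.
  by move=> k kP; rewrite nth_mkseq ?PE // -sz -szP.
- split=> //; first by rewrite szP1 => k /pth.
  by rewrite szP1 => k kl; have [|] := osc k; first lia.
Qed.

(** Inverse of the row removal: interlacing gives the inequality on columns in [osculating_cat], and
    strict increase of [c] gives the other one. *)
Lemma OP_add_row a b al be c P1 :
  cols a.+1 al -> cols b be -> cols b c -> size al = size be ->
  size c = size [seq x <- al | x <= a]%N -> interlace be c ->
  OP a b [seq x <- al | x <= a]%N c P1 -> OP a.+1 b al be (add_row a b be c P1).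
Proof.
set al1 := filter _ _ => Cal Cbe Cc sz szc il [szP1 pathP1 oscP1].
have [sbe sc] := (proj1 (andP Cbe), proj1 (andP Cc)).
case/(interlaceP sbe sc (cols_le Cbe) (cols_le Cc)): il => szs il1 il2.
have be_c k : (k < size be)%N -> (nth 0 be k <= nth b c k <= b)%N.
  move=> kb; have [kl|lk] := ltnP k (size c).
    by rewrite il1 //=; have := cols_nth b Cc kl; lia.
  by rewrite (nth_default _ lk); have := cols_nth 0 Cbe kb; lia.
have st k : (k < size be)%N -> starts_at a (nth b c k) (nth [::] P1 k) /\
    ((k < size c)%N -> (0 < size (nth [::] P1 k))%N).
  move=> kb; have [kl|lk] := ltnP k (size c).
    have kP : (k < size P1)%N by rewrite szP1 -szc.
    have := is_path_starts_at (pathP1 _ kP).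
    by rewrite (set_nth_default b) // => -[].
  by rewrite [nth [::] P1 _]nth_default ?szP1 -?szc.
split; first by rewrite size_mkseq.
- move=> k; rewrite size_mkseq => kb; rewrite nth_mkseq //.
  have [kl|lk] := ltnP k (size c).
    have kP : (k < size P1)%N by rewrite szP1 -szc.
    apply: is_path_cat; first by have := be_c _ kb; lia.
    have := pathP1 _ kP; rewrite [nth 0%N c k](set_nth_default b) //.
    by rewrite -nth_filter_le // -/al1 -szc.
  have [|_ ->] := @nth_filter_gt a al 0%N k Cal; first by rewrite -/al1 -szc lk sz.
  rewrite [nth [::] P1 _]nth_default ?szP1 -?szc // cats0 (nth_default _ lk).
  by apply: is_path_seg; have := be_c _ kb; lia.
move=> k; rewrite size_mkseq => kb; have kb' := ltnW kb.
rewrite !nth_mkseq //; have kc : (k < size c)%N by lia.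
apply/osculating_cat.
- by have := be_c _ kb'; lia.
- by have := be_c _ kb; lia.
- by apply: (sorted_ltn_nth ltn_trans 0%N sbe) => //; rewrite inE; lia.
- exact: (st _ kb').1.
- exact: (st _ kb).1.
- exact: (st _ kb').2.
split; first exact: il2.
  have [kc' _|ck] := ltnP k.+1 (size c); last by rewrite nth_default // szP1 -szc.
  by apply: (sorted_ltn_nth ltn_trans b sc) => //; rewrite inE; lia.
have [kc'|ck] := ltnP k.+1 (size P1); first exact: oscP1.
by rewrite [nth _ _ k.+1]nth_default // => m m' i j _; rewrite ltn0.
Qed.

Lemma count_add_row_top a b be c P1 (p : lpoint) : p.1 <= a%:Z ->
  (size P1 <= size be)%N ->
  count (fun Q : seq lpoint => p \in Q) (add_row a b be c P1) =
  count (fun Q : seq lpoint => p \in Q) P1.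
Proof.
move=> pa sz; rewrite /add_row count_map.
rewrite -{2}(mkseq_nth [::] P1) count_map -(subnKC sz) iotaD count_cat add0n.
rewrite [X in (_ + X)%N](_ : _ = 0%N) ?addn0.
  by apply: eq_count => k /=; rewrite mem_cat mem_seg; case: eqP => //=; lia.
apply/eqP; rewrite -leqn0 leqNgt -has_count; apply/hasPn => k.
rewrite mem_iota /= mem_cat mem_seg => kP; rewrite [nth [::] _ _]nth_default.
  by rewrite in_nil orbF; lia.
by lia.
Qed.

(** Path k meets column j when be_k <= j <= c_k. As be_k <= c_k, the paths that start at or before
    column j split into those through the point and those that left the row before j. *)
Lemma count_add_row_bottom (a b : nat) be c P1 (j : nat) :
  cols b be -> cols b c -> interlace be c -> size P1 = size c ->
  (forall Q : seq lpoint, Q \in P1 -> forall p : lpoint, p \in Q -> p.1 <= a%:Z) ->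
  (1 <= j <= b)%N ->
  (count (fun Q : seq lpoint => (a.+1%:Z, j%:Z) \in Q) (add_row a b be c P1)
    + count (fun x => x < j) c = count (fun x => x < j.+1) be)%N.
Proof.
move=> Cbe Cc il szP1 P1a jb.
have [sbe sc] := (proj1 (andP Cbe), proj1 (andP Cc)).
case/(interlaceP sbe sc (cols_le Cbe) (cols_le Cc)): il => /andP[sz _] il _.
rewrite /add_row count_map.
(* Counting over path indices adds at most one path, whose default column b >= j leaves the count
   unchanged. *)
have -> : count (fun x => x < j)%N c =
    count (fun k => nth b c k < j)%N (iota 0 (size be)).
  rewrite -{1}(mkseq_nth b c) count_map -(subnKC sz) iotaD count_cat add0n.
  rewrite [X in (_ + X)%N](_ : _ = 0%N) ?addn0 //.
  apply/eqP; rewrite -leqn0 leqNgt -has_count; apply/hasPn => k.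
  rewrite mem_iota /= => kP; rewrite nth_default; lia.
rewrite -[in RHS](mkseq_nth 0%N be) count_map -count_predUI.
rewrite [X in (_ + X)%N](_ : _ = 0%N) ?addn0.
  apply: eq_in_count => k; rewrite mem_iota add0n => /= kb.
  rewrite mem_cat mem_seg /= eqxx /=.
  have -> : ((a.+1%:Z, j%:Z) \in nth [::] P1 k) = false.
    apply/negP; have [kP|Pk] := ltnP k (size P1); last by rewrite nth_default.
    by move=> /(P1a _ (mem_nth _ kP)) /=; lia.
  have [kc|ck] := ltnP k (size c); first by have := il _ kc; lia.
  by rewrite (nth_default b ck); lia.
apply/eqP; rewrite -leqn0 leqNgt -has_count; apply/hasPn => k.
rewrite mem_iota add0n => /= kb; rewrite mem_cat mem_seg /= eqxx /=.
have -> : ((a.+1%:Z, j%:Z) \in nth [::] P1 k) = false.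
  apply/negP; have [kP|Pk] := ltnP k (size P1); last by rewrite nth_default.
  by move=> /(P1a _ (mem_nth _ kP)) /=; lia.
by lia.
Qed.

(** * Words along the rows of a path configuration *)

(* [l k], [w (k + 1 - i)] and [w' (k - i)] say whether the edges to the left,
   to the top and to the bottom of the point (i, k) are used; in words, row i
   has the letter [~~ l k] at the left edge. *)
Definition row_rule (i : int) (w w' : int -> bool) (l Zr : nat -> bool)
    (k : nat) : Prop :=
  Zr k = (l k == w' (k%:Z - i)) /\
  (l k + w' (k%:Z - i)%R = l k.+1 + w (k%:Z + 1 - i)%R)%N.

Lemma row_run i w w' (l Zr : nat -> bool) k0 m :
  let h k := fun p : int => if p < k%:Z - i then w' p
    else if p == k%:Z - i then ~~ l k else w p in
  (forall k, (k0 <= k < k0 + m)%N -> row_rule i w w' l Zr k) ->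
  let zs := [seq k%:Z - i | k <- iota k0 m & Zr k] in
  valid (h k0) zs /\ run (h k0) zs = h (k0 + m)%N.
Proof.
move=> h; elim: m k0 => [|m IH] k0 rule /=; first by rewrite addn0.
have {}IH := IH k0.+1 (fun k km => rule k ltac:(lia)).
rewrite addSnnS in IH.
have [Zk flow] : row_rule i w w' l Zr k0 by apply: rule; lia.
have [hl ht] : h k0 (k0%:Z - i) = ~~ l k0 /\
    h k0 (k0%:Z - i + 1) = w (k0%:Z + 1 - i).
  by rewrite /h ltxx eqxx !ifN; [rewrite addrAC|lia..].
case: ifP => Zk0 /=; rewrite Zk0 in Zk.
  have hS : swapw (k0%:Z - i) (h k0) = h k0.+1.
    apply/funext => p; rewrite /swapw hl ht /h.
    case: eqP => [->|pk].
      by rewrite ifT; [case: (l k0) (w' _) (l k0.+1) (w _) Zk flow => [] [] [] []|lia].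
    case: eqP => [->|pk1].
      rewrite ifF; last by lia.
      by rewrite ifT; [case: (l k0) (w' _) (l k0.+1) (w _) Zk flow => [] [] [] []|lia].
    rewrite (_ : (p < k0.+1%:Z - i) = (p < k0%:Z - i)); last by lia.
    case: ifP => // _; rewrite !ifF //; lia.
  rewrite hS IH.1 IH.2 hl ht; split=> //; rewrite andbT.
  by case: (l k0) (w' _) (l k0.+1) (w _) Zk flow => [] [] [] [].
suff hS : h k0 = h k0.+1 by rewrite hS.
apply/funext => p; rewrite {IH hl ht}/h.
have [pk|pk|->] := ltgtP p (k0%:Z - i); first by rewrite ifT //; lia.
  rewrite ifF; last by lia.
  case: eqP => // ->; rewrite (_ : k0.+1%:Z - i = k0%:Z + 1 - i); last by lia.
  by case: (l k0) (w' _) (l k0.+1) (w _) Zk flow => [] [] [] [].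
rewrite ifT; last by lia.
by case: (l k0) (w' _) (l k0.+1) (w _) Zk flow => [] [] [] [].
Qed.

(** Conversely, the horizontal edges are read off from the intermediate words: [l k] negates the
    letter at k - i just before point k is visited. *)
Lemma row_run_inv i w w' (Zr : nat -> bool) k0 m :
  let zs := [seq k%:Z - i | k <- iota k0 m & Zr k] in
  valid w zs -> run w zs = w' ->
  exists l : nat -> bool, [/\ l k0 = ~~ w (k0%:Z - i),
    l (k0 + m)%N = ~~ w' ((k0 + m)%N%:Z - i),
    (forall k, (k0 <= k < k0 + m)%N -> row_rule i w w' l Zr k) &
    (forall p, (p < k0%:Z - i) || ((k0 + m)%N%:Z - i < p) -> w' p = w p)].
Proof.
elim: m k0 w => [|m IH] k0 w /=.
  by move=> _ <-; exists (fun=> ~~ w (k0%:Z - i)); split; rewrite ?addn0 //; lia.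
move=> val runw.
pose w1 := if Zr k0 then swapw (k0%:Z - i) w else w.
have [] := IH k0.+1 w1.
- by move: val; rewrite /w1; case: ifP => //= _ /andP[].
- by move: runw; rewrite /w1; case: ifP.
move=> l [lk0 lm rule out]; rewrite addSnnS in lm rule out.
have w1out p : (p != k0%:Z - i) && (p != k0%:Z - i + 1) -> w1 p = w p.
  by rewrite /w1; case: ifP => // _ /andP[/negPf p0 /negPf p1]; rewrite /swapw p0 p1.
pose l' k := if k == k0 then ~~ w (k0%:Z - i) else l k.
have l'S k : (k0 < k)%N -> l' k = l k by move=> kk; rewrite /l' ifF //; lia.
exists l'; split.
- by rewrite /l' eqxx.
- by rewrite l'S //; lia.
- move=> k km; have [kk0|kk0] := eqVneq k k0; last first.
    have [] : row_rule i w1 w' l Zr k by apply: rule; lia.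
    rewrite /row_rule !l'S; [|lia..].
    by rewrite w1out //; lia.
  rewrite kk0 /row_rule (l'S k0.+1) // /l' eqxx lk0.
  rewrite (_ : k0.+1%:Z - i = k0%:Z - i + 1); last by lia.
  rewrite (_ : k0%:Z + 1 - i = k0%:Z - i + 1); last by lia.
  rewrite out; last by lia.
  move: val; rewrite /w1; case: ifP => Zk.
    rewrite /= /swapw !eqxx ifF; last by lia.
    by case: (w _) (w _) => [] [].
  by case: (w _) (w _) => [] [].
- by move=> p pk; rewrite out ?w1out //; lia.
Qed.

(* The letters along the bottom and right sides of the rectangle: 1 where a path
   starts at the bottom, and 0 where a path ends on the right. *)
Definition boundary_word (a b : nat) (al be : seq nat) : int -> bool := fun p =>
  if p <= - a%:Z then true else
  if p <= b%:Z - a%:Z then `|(p + a%:Z)%R|%N \in be else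
  if p <= b%:Z then `|(b%:Z + 1 - p)%R|%N \notin al else false.

Definition contents (a b : nat) (Z : pred lpoint) : seq int :=
  [seq content p | p <- rect a b & Z p].

Lemma contentsS a b (Z : pred lpoint) : contents a.+1 b Z =
  contents a b Z ++ [seq j%:Z - a.+1%:Z | j <- iota 1 b & Z (a.+1%:Z, j%:Z)].
Proof.
rewrite /contents /rect (_ : iota 1 a.+1 = iota 1 a ++ [:: a.+1]).
  by rewrite allpairs_cat filter_cat map_cat /= cats0 filter_map -map_comp.
by rewrite -(addn1 a) iotaD /= add1n addn1.
Qed.

Lemma mem_rect a b (p : lpoint) :
  (p \in rect a b) = (1 <= p.1 <= a%:Z) && (1 <= p.2 <= b%:Z).
Proof.
case: p => p1 p2; apply/allpairsP/idP => [[[i j] /= []]|/= rng].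
  by rewrite !mem_iota => ia jb [-> ->]; lia.
exists (`|p1|%N, `|p2|%N); rewrite !mem_iota /=.
by split; [lia|lia|congr (_, _); lia].
Qed.

Lemma count_ltS j (s : seq nat) : uniq s ->
  count (fun x => x < j.+1)%N s = (count (fun x => x < j)%N s + (j \in s))%N.
Proof.
move=> us; rewrite -count_uniq_mem // -count_predUI.
rewrite [X in (_ + X)%N](_ : _ = 0%N) ?addn0; last first.
  by apply/eqP; rewrite -leqn0 leqNgt -has_count; apply/hasPn => x _ /=; lia.
by apply: eq_count => x /=; lia.
Qed.

Lemma cols_uniq b s : cols b s -> uniq s.
Proof. by case/andP=> /(sorted_uniq ltn_trans ltnn). Qed.

Lemma cols_count b s j : cols b s ->
  count (fun x => x < j)%N s = count (fun x => x < minn j b.+1)%N s.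
Proof.
case/andP=> _ /allP rng; apply: eq_in_count => x /rng; lia.
Qed.

Lemma cols_count1 b s j : cols b s -> (j <= 1)%N ->
  count (fun x => x < j)%N s = 0%N.
Proof.
case/andP=> _ /allP rng j1; apply/eqP; rewrite -leqn0 leqNgt -has_count.
by apply/hasPn => x /rng; lia.
Qed.

Lemma cols_count_size b s : cols b s -> count (fun x => x < b.+1)%N s = size s.
Proof.
by case/andP=> _ rng; apply/eqP; rewrite -all_count; apply: sub_all rng => x; lia.
Qed.

Lemma vacancy_osculationE P p : vacancy P p || osculation P p =
  (count (fun Q : seq lpoint => p \in Q) P \in [:: 0; 2])%N.
Proof. by rewrite /vacancy /osculation has_count -eqn0Ngt !inE. Qed.

Lemma OP_rows a b al be P : OP a b al be P ->
  forall Q : seq lpoint, Q \in P -> forall p : lpoint, p \in Q -> p.1 <= a%:Z.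
Proof.
move=> [_ pth _] Q /(nthP [::])[k kP <-].
by have [[]] := is_path_starts_at (pth _ kP).
Qed.

(** A path through a point of the new row comes from the left or starts there. The number of paths
    is thus a sum of two bits, and it is 0 or 2 exactly when the bits agree. *)
Lemma row_points a b be c P1 j : cols b be -> cols b c -> interlace be c ->
  size P1 = size c ->
  (forall Q : seq lpoint, Q \in P1 -> forall p : lpoint, p \in Q -> p.1 <= a%:Z) ->
  (1 <= j <= b)%N ->
  let P := add_row a b be c P1 in
  let l := (count (fun x => x < j) c < count (fun x => x < j) be)%N in
  vacancy P (a.+1%:Z, j%:Z) || osculation P (a.+1%:Z, j%:Z) = (l == (j \in be)).
Proof.
move=> Cbe Cc il sz rows jb P l; rewrite vacancy_osculationE.
have := count_add_row_bottom Cbe Cc il sz rows jb.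
rewrite -/P count_ltS ?(cols_uniq Cbe) //; have := il j; rewrite !inE /l.
move: (count _ P) (count _ c) (count _ be) => n1 n2 n3.
by case: (j \in be); rewrite ?eqb_id ?eqbF_neg; lia.
Qed.

Lemma boundary_word_low a b al be p : p <= - a%:Z -> boundary_word a b al be p.
Proof. by rewrite /boundary_word => ->. Qed.

Lemma boundary_word_bottom a b al be j : (1 <= j <= b)%N ->
  boundary_word a b al be (j%:Z - a%:Z) = (j \in be).
Proof.
move=> jb; rewrite /boundary_word ifF ?ifT; [|lia..].
by rewrite (_ : `|_|%N = j) //; lia.
Qed.

Lemma boundary_word_right a b al be x : (1 <= x <= a)%N ->
  boundary_word a b al be (b%:Z + 1 - x%:Z) = (x \notin al).
Proof.
move=> xa; rewrite /boundary_word 2?ifF ?ifT; [|lia..].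
by rewrite (_ : `|_|%N = x) //; lia.
Qed.

Lemma boundary_word_high a b al be p : b%:Z < p -> boundary_word a b al be p = false.
Proof. by move=> bp; rewrite /boundary_word !ifF //; lia. Qed.

Lemma boundary_wordP a b al be w : w = boundary_word a b al be <->
  [/\ forall p : int, p <= - a%:Z -> w p,
      forall j, (1 <= j <= b)%N -> w (j%:Z - a%:Z) = (j \in be),
      forall x, (1 <= x <= a)%N -> w (b%:Z + 1 - x%:Z) = (x \notin al) &
      forall p : int, b%:Z < p -> w p = false].
Proof.
split=> [->|[low bot right high]].
  split; [exact: boundary_word_low|exact: boundary_word_bottom|
    exact: boundary_word_right|exact: boundary_word_high].
apply/funext => p; have [pa|pa] := lerP p (- a%:Z).
  by rewrite low // boundary_word_low.
have [pba|pba] := lerP p (b%:Z - a%:Z).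
  have -> : p = `|(p + a%:Z)%R|%N%:Z - a%:Z by lia.
  by rewrite bot ?boundary_word_bottom //; lia.
have [pb|pb] := lerP p b%:Z; last by rewrite high // boundary_word_high.
have -> : p = b%:Z + 1 - `|(b%:Z + 1 - p)%R|%N%:Z by lia.
by rewrite right ?boundary_word_right //; lia.
Qed.

Lemma size_filter_le a al : cols a.+1 al ->
  size al = (size [seq x <- al | x <= a]%N + (a.+1 \in al))%N.
Proof.
move=> Cal; rewrite {1}(sorted_split_max (proj1 (andP Cal)) (cols_le Cal)).
by rewrite size_cat size_nseq.
Qed.

Lemma mem_filter_le a x al : (x <= a)%N ->
  (x \in [seq y <- al | y <= a]%N) = (x \in al).
Proof. by move=> xa; rewrite mem_filter xa. Qed.

(** The conservation law is summed over the columns to the left of j; nothing enters the row at its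
    left end. *)
Lemma count_flow b be c (l : nat -> bool) : cols b be -> cols b c ->
  l 1%N = false ->
  (forall k, (1 <= k <= b)%N -> (l k + (k \in be) = l k.+1 + (k \in c))%N) ->
  forall j, (1 <= j <= b.+1)%N ->
    (count (fun x => x < j) be = count (fun x => x < j) c + l j)%N.
Proof.
move=> Cbe Cc l10 flow; elim=> // j IHj jb; have [->|j0] := eqVneq j 0%N.
  by rewrite l10 !(cols_count1 Cbe) ?(cols_count1 Cc).
have e1 := IHj ltac:(lia); have e2 := flow j ltac:(lia).
rewrite !count_ltS ?(cols_uniq Cbe) ?(cols_uniq Cc) // e1.
by rewrite -addnA e2 addnA addnAC.
Qed.

Lemma interlace_flow b be c (l : nat -> bool) : cols b be -> cols b c ->
  (forall j, (1 <= j <= b.+1)%N ->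
    (count (fun x => x < j) be = count (fun x => x < j) c + l j)%N) ->
  interlace be c.
Proof.
move=> Cbe Cc lE j; have [->|j0] := eqVneq j 0%N.
  by rewrite !(cols_count1 Cbe) ?(cols_count1 Cc).
rewrite (cols_count j Cbe) (cols_count j Cc) lE; last by lia.
by move: (count _ c) => m; case: (l _); clear; lia.
Qed.

Lemma cols0_nil (al be : seq nat) : cols 0 al -> size al = size be -> al = [::] /\ be = [::].
Proof.
case/andP=> _ /allP rng; case: al rng => [_ /esym /size0nil //|x al].
by move=> /(_ x (mem_head _ _)); lia.
Qed.

(** Induction on the number of rows: the word reached after the first [a] rows is the boundary word
    of the truncated paths, and [row_run] carries it across the bottom row. *)
Lemma OP_run a b al be P (Z : pred lpoint) :
  cols a al -> cols b be -> size al = size be -> OP a b al be P ->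
  {in rect a b, forall p, Z p = vacancy P p || osculation P p} ->
  valid word0 (contents a b Z) /\
  run word0 (contents a b Z) = boundary_word a b al be.
Proof.
elim: a al be P => [|a IH] al be P Cal Cbe sz PO ZP.
  have [-> ->] := cols0_nil Cal sz; split=> //; apply/boundary_wordP.
  by rewrite /word0; split=> [p|j|x|p] /=; rewrite ?in_nil; lia.
have [c [P1 [Cc szc il PE PO1]]] := OP_row_split Cal Cbe sz PO.
set al1 := filter _ _ in szc PO1.
have Cal1 : cols a al1 := cols_filter Cal.
have szP1 : size P1 = size c by case: PO1 => -> _ _.
have szcb : (size P1 <= size be)%N.
  by rewrite szP1 szc -sz size_filter count_size.
have [|val runw] := IH al1 c P1 Cal1 Cc (esym szc) PO1.
  move=> p pr; have pr' : p \in rect a.+1 b by move: pr; rewrite !mem_rect; lia.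
  rewrite ZP // !vacancy_osculationE PE count_add_row_top //.
  by move: pr; rewrite mem_rect; lia.
rewrite contentsS valid_cat run_cat val runw {IH val runw}.
have /boundary_wordP [] := erefl (boundary_word a b al1 c).
have /boundary_wordP [] := erefl (boundary_word a.+1 b al be).
set w := boundary_word a b al1 c; set w' := boundary_word a.+1 b al be.
move=> low' bot' right' high' low bot right high.
pose l j := (count (fun x => x < j) c < count (fun x => x < j) be)%N.
have lE j : (count (fun x => x < j) be = count (fun x => x < j) c + l j)%N.
  by have := il j; rewrite /l; clear; case: ltnP; lia.
pose h k := fun p : int => if p < k%:Z - a.+1%:Z then w' p
  else if p == k%:Z - a.+1%:Z then ~~ l k else w p.
pose Zr j := Z (a.+1%:Z, j%:Z).
have rule k : (1 <= k < 1 + b)%N -> row_rule a.+1%:Z w w' l Zr k.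
  rewrite add1n ltnS => kb; rewrite /row_rule bot' //.
  have -> : k%:Z + 1 - a.+1%:Z = k%:Z - a%:Z by clear; lia.
  rewrite bot //; split.
    rewrite /Zr ZP; last by move: kb; rewrite mem_rect /=; clear; lia.
    by rewrite PE row_points //; exact: OP_rows PO1.
  have := lE k.+1; rewrite !count_ltS ?(cols_uniq Cbe) ?(cols_uniq Cc) // lE.
  by rewrite -!addnA => /addnI ->; rewrite addnC.
have h1 : h 1%N = w.
  apply/funext => p; rewrite /h; case: ifP => [pa|pa].
    by rewrite low' ?low //; move: pa; clear; lia.
  case: eqP => // ->; rewrite /l !(cols_count1 Cbe) ?(cols_count1 Cc) //.
  by rewrite low //; clear; lia.
have [] := row_run rule; rewrite -/(h _) -/(h _) h1 => -> ->; split=> //.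
apply/boundary_wordP; rewrite /h add1n; split.
- by move=> p pa; rewrite ifT ?low' //; move: pa; clear; lia.
- move=> j jb; rewrite ifT ?bot' //; move: jb; clear; lia.
(* For x = a + 1 the letter is that of the right edge of the bottom row, used exactly when [be] has
   one entry more than [c], that is, when a path ends in this row. *)
- move=> x /andP[x1]; rewrite leq_eqVlt => /orP[/eqP-> |xa].
    rewrite ifF ?ifT; [|clear; lia..].
    rewrite /l !(cols_count_size Cbe) !(cols_count_size Cc) szc -sz.
    by rewrite (size_filter_le Cal) -/al1; clear; case: (_ \in _); lia.
  rewrite !ifF; [|move: xa; clear; lia..].
  by rewrite right ?mem_filter_le //; lia.
- by move=> p pb; rewrite !ifF ?high //; move: pb; clear; lia.
Qed.

(** The word [w] after the first [a] rows must be shown to be a boundary word again. Its letters at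
    1 - a, ..., b - a define the starting columns [c]; no swap of these rows reaches the positions
    up to -a, and row [a.+1] does not reach those above b - a, where [w] therefore agrees with the
    final word. The edges found by [row_run_inv] then give the interlacing. *)
Lemma OP_of_run a b al be (Z : pred lpoint) :
  cols a al -> cols b be -> size al = size be ->
  valid word0 (contents a b Z) ->
  run word0 (contents a b Z) = boundary_word a b al be ->
  exists P, OP a b al be P /\
    {in rect a b, forall p, Z p = vacancy P p || osculation P p}.
Proof.
elim: a al be => [|a IH] al be Cal Cbe sz.
  move=> _ _; have [-> ->] := cols0_nil Cal sz.
  by exists [::]; split; [|move=> p; rewrite mem_rect; lia].
rewrite contentsS valid_cat run_cat => /andP[val val'] runw.
have [l [l1 lb rule out]] := row_run_inv val' runw.
move: out rule lb l1 val {val' runw}; rewrite add1n.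
have /boundary_wordP [] := erefl (boundary_word a.+1 b al be).
set w := run word0 _; set w' := boundary_word a.+1 b al be.
move=> low' bot' right' high' out rule lb l1 val.
set al1 := [seq x <- al | x <= a]%N.
have Cal1 : cols a al1 := cols_filter Cal.
pose c := [seq j <- iota 1 b | w (j%:Z - a%:Z)].
have Cc : cols b c.
  apply/andP; split.
    by apply: sorted_filter; [exact: ltn_trans|exact: iota_ltn_sorted].
  apply/allP => j; rewrite mem_filter mem_iota => /andP[_]; clear; lia.
have w_low p : p <= - a%:Z -> w p.
  move=> pa; rewrite /w run_out; first by rewrite /word0; move: pa; clear; lia.
  move=> z /mapP[q]; rewrite mem_filter mem_rect => /andP[_ qr] ->.
  by move: pa qr; rewrite /content; clear; lia.
have w_bot j : (1 <= j <= b)%N -> w (j%:Z - a%:Z) = (j \in c).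
  by move=> jb; rewrite mem_filter mem_iota add1n ltnS jb andbT.
have wE : w = boundary_word a b al1 c.
  apply/boundary_wordP; split=> //.
    move=> x xa; rewrite mem_filter_le; last by case/andP: xa.
    rewrite -right'; last by move: xa; clear; lia.
    by rewrite out //; move: xa; clear; lia.
  by move=> p pb; rewrite -out ?high' //; move: pb; clear; lia.
have flow k : (1 <= k <= b)%N ->
    (l k + (k \in be) = l k.+1 + (k \in c))%N.
  move=> kb; have [] := rule k; first by rewrite ltnS.
  have -> : k%:Z + 1 - a.+1%:Z = k%:Z - a%:Z by clear; lia.
  by rewrite bot' // w_bot.
have l10 : l 1%N = false by rewrite l1 w_low //; clear; lia.
have lE := count_flow Cbe Cc l10 flow.
have il := interlace_flow Cbe Cc lE.
have szc : size c = size al1.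
  have := lE b.+1; rewrite (cols_count_size Cbe) (cols_count_size Cc) -sz lb.
  rewrite (_ : b.+1%:Z - a.+1%:Z = b%:Z + 1 - a.+1%:Z); last by clear; lia.
  rewrite right' ?leqnn // (size_filter_le Cal) negbK => /(_ isT).
  by move/addIn.
have [P1 [PO1 ZP1]] := IH al1 c Cal1 Cc (esym szc) val wE.
have szP1 : size P1 = size c by case: PO1 => -> _ _.
have szcb : (size P1 <= size be)%N.
  by rewrite szP1 szc -sz size_filter count_size.
exists (add_row a b be c P1); split; first exact: OP_add_row.
move=> [p1 p2] pr; have [pa|pa] := lerP p1 a%:Z.
  rewrite ZP1; last by move: pr pa; rewrite !mem_rect /=; clear; lia.
  by rewrite !vacancy_osculationE count_add_row_top.
have [j jb ->] : exists2 j, (1 <= j <= b)%N & (p1, p2) = (a.+1%:Z, j%:Z).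
  move: pr pa; rewrite mem_rect /=; clear => pr pa.
  by exists `|p2|%N; [|congr (_, _)]; lia.
rewrite row_points //; last exact: OP_rows PO1.
have [|-> _] := rule j; first by rewrite ltnS.
rewrite lE; last by move: jb; clear; lia.
rewrite bot' // -[X in (X < _)%N]addn0 ltn_add2l lt0b //.
Qed.

(** * Partitions as words *)

Lemma part_mono (la : intpart) i j : (i <= j)%N -> (part la j <= part la i)%N.
Proof.
move=> ij; rewrite /part; case: (ltnP j.-1 (size la)) => [jla|?]; last first.
  by rewrite nth_default.
case/andP: (valP la) => srt _.
have geT : transitive geq by move=> y x z /= yx zy; exact: leq_trans zy yx.
have geR : reflexive geq by move=> ?; exact: leqnn.
have ij1 : (i.-1 <= j.-1)%N by lia.
exact: (sorted_leq_nth geT geR 0%N srt _ _ (leq_ltn_trans ij1 jla) jla ij1).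
Qed.

Lemma part_pos (la : intpart) i : (0 < i)%N -> (0 < part la i)%N = (i <= size la)%N.
Proof.
case: i => // i _; rewrite /part /=; case: (ltnP i (size la)) => [ila|lai].
  rewrite lt0n; case/andP: (valP la) => _; apply: contra => /eqP e.
  by have := mem_nth 0%N ila; rewrite e.
by rewrite nth_default.
Qed.

Lemma part_inj (la mu : intpart) :
  (forall i, (0 < i)%N -> part la i = part mu i) -> la = mu.
Proof.
move=> eq_p; apply: val_inj => /=; apply: (@eq_from_nth _ 0%N); last first.
  by move=> i _; exact: (eq_p i.+1).
have le (nu ka : intpart) : (forall i, (0 < i)%N -> part nu i = part ka i) ->
    (size nu <= size ka)%N.
  move=> e; have [->//|s0] := posnP (size nu).
  by rewrite -part_pos // -e // part_pos.
by apply/eqP; rewrite eqn_leq !le // => i /eq_p.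
Qed.

Lemma nth_filter_pos (s : seq nat) k : sorted geq s ->
  nth 0%N [seq x <- s | x != 0%N] k = nth 0%N s k.
Proof.
have geT : transitive geq by move=> y x z /= yx zy; exact: leq_trans zy yx.
elim: s k => //= x s IH k xs; have := IH _ (path_sorted xs) => {}IH.
have [x0|x0] := eqVneq x 0%N; last by case: k => //= k; exact: IH.
rewrite IH; have /allP s0 := order_path_min geT xs.
have nth0s i : nth 0%N s i = 0%N.
  have [si|is_] := leqP (size s) i; first by rewrite nth_default.
  by have /= := s0 _ (mem_nth 0%N is_); lia.
by case: k => [|k] /=; rewrite !nth0s.
Qed.

Lemma part_exists (f : nat -> nat) n :
  (forall i, (0 < i)%N -> (f i.+1 <= f i)%N) ->
  (forall i, (n < i)%N -> f i = 0%N) ->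
  exists la : intpart, forall i, (0 < i)%N -> part la i = f i.
Proof.
move=> fmono f0; pose s := [seq f i | i <- iota 1 n].
have srt : sorted geq s.
  apply/(sortedP 0%N) => i; rewrite size_map size_iota => i_n.
  by rewrite !(nth_map 0%N) ?size_iota ?nth_iota; [exact: fmono|lia..].
have nth_s i : nth 0%N s i = f i.+1.
  have [ni|i_n] := leqP n i; first by rewrite nth_default ?size_map ?size_iota ?f0.
  by rewrite (nth_map 0%N) ?size_iota ?nth_iota.
have wf : sorted geq [seq x <- s | x != 0%N] && (0%N \notin [seq x <- s | x != 0%N]).
  rewrite mem_filter eqxx andbT sorted_filter //.
  by move=> y x z /= yx zy; exact: leq_trans zy yx.
by exists (IntPart wf) => -[//|i] _; rewrite /part /= nth_filter_pos.
Qed.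

(** The zero parts fill all positions up to -size; splitting them off leaves a finite list and a
    boolean definition. *)
Definition maya (la : intpart) : int -> bool := fun p =>
  (p <= - (size la)%:Z) ||
  (p \in [seq (part la i)%:Z - i%:Z + 1 | i <- iota 1 (size la)]).

Lemma mayaP la p :
  reflect (exists2 i, (0 < i)%N & p = (part la i)%:Z - i%:Z + 1) (maya la p).
Proof.
apply: (iffP orP) => [[ple|/mapP[i]]|[i i_gt0 ->]].
- exists `|1 - p|%N; first by lia.
  by have := @part_pos la `|1 - p|%N; lia.
- by rewrite mem_iota => ir ->; exists i; lia.
have [i_la|la_i] := leqP i (size la); [right|left].
  by apply/mapP; exists i; rewrite // mem_iota; lia.
by have := part_pos la i_gt0; lia.
Qed.

Lemma bead_inj (la : intpart) i j :
  (part la i)%:Z - i%:Z = (part la j)%:Z - j%:Z -> i = j.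
Proof.
by case: (ltngtP i j) => // ij; have := part_mono la (ltnW ij); lia.
Qed.

(** The parts are recovered one by one. If the i-th part of [la] were the larger one, its bead would
    be the k-th bead of [mu] for some k < i, and by induction also the k-th bead of [la], against
    [bead_inj]. *)
Lemma maya_inj : injective maya.
Proof.
have main la mu i : maya la = maya mu -> (0 < i)%N ->
    (forall j, (0 < j < i)%N -> part la j = part mu j) ->
    (part la i <= part mu i)%N.
  move=> eq_m i_gt0 IH; rewrite leqNgt; apply/negP => lt.
  have : maya mu ((part la i)%:Z - i%:Z + 1) by rewrite -eq_m; apply/mayaP; exists i.
  case/mayaP => k k_gt0 e.
  have ki : (k < i)%N.
    by rewrite ltnNge; apply/negP => ik; have := part_mono mu ik; lia.
  have := IH k; rewrite k_gt0 ki => /(_ isT) eqk.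
  by have := @bead_inj la i k; lia.
move=> la mu eq_m; apply: part_inj => i.
elim/ltn_ind: i => i IH i_gt0; apply/eqP; rewrite eqn_leq.
rewrite !main //; first by move=> j /andP[j_gt0 ji]; rewrite IH.
by move=> j /andP[j_gt0 ji]; rewrite IH.
Qed.

Lemma maya_empty : maya empty_part = word0.
Proof. by apply/funext => p; rewrite /maya /= in_nil orbF. Qed.

Lemma swapwK z : involutive (swapw z).
Proof.
move=> w; apply/funext => p; rewrite /swapw !eqxx.
case: eqP => [->|_]; first by rewrite ifF //; lia.
by case: eqP => // ->.
Qed.

Lemma swapw_neq z w : (swapw z w z != swapw z w (z + 1)) = (w z != w (z + 1)).
Proof. by rewrite /swapw !eqxx ifF; [rewrite eq_sym|lia]. Qed.

Lemma mem_young la (p : lpoint) :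
  (p \in young la) = [&& 1 <= p.1, 1 <= p.2 & p.2 <= (part la `|p.1|%N)%:Z].
Proof.
rewrite !inE /= mem_rect; apply/andP/and3P => [|[p1 p2 p2le]].
  by case=> /andP[/andP[p1 _] /andP[p2 _]] ->.
have := @part_pos la `|p.1|%N; have := @part_mono la 1 `|p.1|%N; split=> //; lia.
Qed.

Lemma young_addP (la mu : intpart) (p : lpoint) :
  p \notin young la /\ young mu = (p |` young la)%fset <->
  exists2 i, (0 < i)%N & p = (i%:Z, (part la i).+1%:Z) /\
    forall j, (0 < j)%N -> part mu j = (part la j + (j == i))%N.
Proof.
split=> [[pla eqy]|[i i_gt0 [-> mu_la]]].
  have mem i j : (0 < i)%N -> (0 < j)%N -> (j <= part mu i)%N =
      (((i%:Z, j%:Z) : lpoint) == p) || (j <= part la i)%N.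
    move=> i_gt0 j_gt0.
    have : (((i%:Z, j%:Z) : lpoint) \in young mu) =
           (((i%:Z, j%:Z) : lpoint) \in (p |` young la)%fset) by rewrite eqy.
    by rewrite in_fset1U !mem_young /=; move: (_ == p) => B; lia.
  have : p \in young mu by rewrite eqy fset1U1.
  rewrite mem_young => /and3P[p1 p2 _].
  case: p => [pi pj] in pla eqy mem p1 p2 *.
  rewrite mem_young /= in pla p1 p2.
  have piE : pi = `|pi|%N by lia.
  have pjE : pj = `|pj|%N by lia.
  move: `|pi|%N `|pj|%N piE pjE => i0 j0 piE pjE; subst pi pj.
  rewrite absz_nat in pla; exists i0; first by lia.
  have {}mem i j : (0 < i)%N -> (0 < j)%N -> (j <= part mu i)%N =
      ((i == i0) && (j == j0)) || (j <= part la i)%N.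
    by move=> i_gt0 j_gt0; rewrite mem // xpair_eqE.
  have la0 : part la i0 = j0.-1.
    have [j01|j01] := leqP j0 1; first by lia.
    have := mem i0 j0.-1; have := mem i0 j0; lia.
  split; first by congr (_, _); lia.
  move=> i i_gt0; have m1 := mem i (part mu i) i_gt0.
  have m2 := mem i (part la i) i_gt0.
  have m3 := mem i j0 i_gt0.
  have m4 := mem i (part la i).+1 i_gt0.
  by case: eqP => [ii|ii]; [subst i|]; lia.
split; first by rewrite mem_young /=; lia.
apply/fsetP => -[i' j']; rewrite in_fset1U !mem_young xpair_eqE /=.
have [i'1|i'1] := lerP 1 i'; last by lia.
have := mu_la `|i'|%N.
have -> : (i' == i%:Z) = (`|i'|%N == i) by lia.
by case: eqP => [->|]; lia.
Qed.

(** Lengthening row i moves its bead from z to z + 1. The target is free, for otherwise [mu] would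
    have two beads there. *)
Lemma maya_add (la mu : intpart) i : (0 < i)%N ->
  (forall j, (0 < j)%N -> part mu j = (part la j + (j == i))%N) ->
  let z := (part la i)%:Z - i%:Z + 1 in
  [/\ maya la z, ~~ maya la (z + 1) & maya mu = swapw z (maya la)].
Proof.
move=> i_gt0 mu_la z; have zE : z = (part la i)%:Z - i%:Z + 1 by [].
have laz : maya la z by apply/mayaP; exists i.
have laz1 : ~~ maya la (z + 1).
  apply/mayaP => -[j j_gt0 e].
  have := @bead_inj mu i j; have := mu_la _ i_gt0; have := mu_la _ j_gt0.
  by rewrite eqxx; case: eqP => [ji|ji]; [subst j|]; lia. 
split=> //; apply/funext => p; rewrite /swapw.
case: eqP => [->|pz].
  rewrite (negPf laz1); apply/negP => /mayaP[j j_gt0 e].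
  have := mu_la _ i_gt0; have := mu_la _ j_gt0; have := @bead_inj la i j.
  by rewrite eqxx; case: eqP => [ji|ji]; [subst j|]; lia. 
case: eqP => [->|pz1].
  by rewrite laz; apply/mayaP; exists i; rewrite // mu_la // eqxx; lia.
apply/mayaP/mayaP => -[j j_gt0 e]; exists j => //; have := mu_la _ j_gt0.
  by case: eqP => [ji|_]; [subst j|]; lia.
by case: eqP => [ji|_]; [subst j|]; lia.
Qed.

Lemma differ_at_maya la mu p : differ_at la mu p ->
  maya la (content p) != maya la (content p + 1) /\
  maya mu = swapw (content p) (maya la).
Proof.
have cE (nu : intpart) i :
    content (i%:Z, (part nu i).+1%:Z) = (part nu i)%:Z - i%:Z + 1.
  by rewrite /content /=; lia.
case=> /young_addP[i i_gt0 [-> /(maya_add i_gt0)]]; rewrite -cE => -[z z1 ->].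
  by rewrite z (negPf z1).
by rewrite swapwK swapw_neq z (negPf z1).
Qed.

(** A bead at z with a hole at z + 1 lets its row grow: a row of equal length just above would have
    its bead at z + 1. A bead at z + 1 with a hole at z lets its row shrink, since an equally long
    row just below would have its bead at z. *)
Lemma maya_swap_exists la z : maya la z != maya la (z + 1) ->
  exists mu p, differ_at la mu p /\ content p = z.
Proof.
case: (boolP (maya la z)) => [/mayaP[i i_gt0 zE]|lanz].
  move=> laz1; pose f j := (part la j + (j == i))%N.
  have [mu muE] : exists mu : intpart, forall j, (0 < j)%N -> part mu j = f j.
    apply: (@part_exists _ (maxn (size la) i)) => j j_gt0; rewrite /f.
      have := part_mono la (leqnSn j).
      have : ~ (j.+1 = i /\ part la j = part la i).
        move=> [ji e]; move/negP: laz1; apply; apply/eqP/esym/mayaP.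
        by exists j => //; lia.
      by case: (eqVneq j.+1 i) => [<-|_] /=; lia.
    by have := @part_pos la j; lia.
  exists mu, (i%:Z, (part la i).+1%:Z); split; last by rewrite /content /=; lia.
  by left; apply/young_addP; exists i.
case: (boolP (maya la (z + 1))) => // /mayaP[i i_gt0 zE] _.
pose f j := (part la j - (j == i))%N.
have f1 : (part la i.+1 < part la i)%N.
  have := part_mono la (leqnSn i); rewrite leq_eqVlt => /orP[/eqP e|//].
  by case/mayaP: lanz; exists i.+1 => //; lia.
have [mu muE] : exists mu : intpart, forall j, (0 < j)%N -> part mu j = f j.
  apply: (@part_exists _ (size la)) => j j_gt0; rewrite /f.
    have := part_mono la (leqnSn j).
    by case: (eqVneq j i) => [->|_] /=; lia.
  by have := @part_pos la j; lia.
exists mu, (i%:Z, (part la i)%:Z); split; last by rewrite /content /=; lia.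
right; apply/young_addP; exists i => //; rewrite muE // /f eqxx; split.
  by congr (_, _); lia.
by move=> j j_gt0; rewrite muE // /f; case: eqP => [->|] /=; lia.
Qed.

Lemma DeltaP la mu : differ la mu ->
  maya la (Delta la mu) != maya la (Delta la mu + 1) /\
  maya mu = swapw (Delta la mu) (maya la).
Proof.
move=> [p dp]; rewrite /Delta; case: xgetP => [z -> [q dq <-]|/(_ (content p))].
  exact: differ_at_maya.
by case; exists p.
Qed.

Lemma Delta_content la mu p : differ_at la mu p -> Delta la mu = content p.
Proof.
move=> dp; have [|n1 e1] := @DeltaP la mu; first by exists p.
by have [n2 e2] := differ_at_maya dp; apply: (swapw_inj n1 n2); rewrite -e1 e2.
Qed.

(** * Oscillating tableaux and Frobenius notation *)

Lemma differ_chain_run mu (s : seq intpart) :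
  (forall k, (k < size s)%N ->
     differ (nth empty_part (mu :: s) k) (nth empty_part (mu :: s) k.+1)) ->
  valid (maya mu) (pairmap Delta mu s) /\
  run (maya mu) (pairmap Delta mu s) = maya (last mu s).
Proof.
elim: s mu => //= nu s IH mu ch.
have [neq eqw] := DeltaP (ch 0%N isT).
by rewrite neq -eqw; apply: IH => k ks; exact: (ch k.+1).
Qed.

(** The shapes are rebuilt swap by swap, and the last one is [la] by injectivity of [maya]. *)
Lemma differ_chain_exists mu zs la :
  valid (maya mu) zs -> run (maya mu) zs = maya la ->
  exists s : seq intpart, [/\ size s = size zs, last mu s = la,
    pairmap Delta mu s = zs &
    forall k, (k < size s)%N ->
      differ (nth empty_part (mu :: s) k) (nth empty_part (mu :: s) k.+1)].
Proof.
elim: zs mu => [|z zs IH] mu /=.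
  by move=> _ /maya_inj ->; exists [::].
move=> /andP[neq val] runw.
have [nu [p [d cp]]] := maya_swap_exists neq.
have [_ eqw] := differ_at_maya d; rewrite cp in eqw.
have [||s [szs lst prof ch]] := IH nu; rewrite ?eqw //.
exists (nu :: s); split=> //=; first by rewrite szs.
  by rewrite prof (Delta_content d) cp.
by case=> [_|k ks]; [exists p|exact: ch].
Qed.

Lemma differ_chain_inj mu (s s' : seq intpart) :
  let ch (s : seq intpart) := forall k, (k < size s)%N ->
     differ (nth empty_part (mu :: s) k) (nth empty_part (mu :: s) k.+1) in
  ch s -> ch s' -> pairmap Delta mu s = pairmap Delta mu s' -> s = s'.
Proof.
move=> /=; elim: s s' mu => [|nu s IH] [|nu' s'] mu //= ch ch' [e es].
have [_ e1] := DeltaP (ch 0%N isT); have [_ e2] := DeltaP (ch' 0%N isT).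
have nuE : nu = nu' by apply: maya_inj; rewrite e1 e2 /= e.
subst nu'; congr (_ :: _).
by apply: IH es => k ks; [exact: (ch k.+1)|exact: (ch' k.+1)].
Qed.

Lemma OT_cons la l eta : OT la l eta ->
  exists s : seq intpart, [/\ eta = empty_part :: s, size s = l,
    last empty_part s = la & forall k, (k < size s)%N ->
      differ (nth empty_part (empty_part :: s) k)
        (nth empty_part (empty_part :: s) k.+1)].
Proof.
case: eta => [[]//|mu s] [/= [sz] mu0 lst ch]; subst mu; exists s; split=> //.
  by rewrite -lst -sz; case: (s) => //= x t; rewrite nth_last.
by rewrite sz.
Qed.

Lemma OT_run la l eta : OT la l eta ->
  [/\ size (profile eta) = l, valid word0 (profile eta) &
      run word0 (profile eta) = maya la].
Proof.
case/OT_cons => s [-> sz lst /differ_chain_run[]]; rewrite /profile /= maya_empty.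
by rewrite lst size_pairmap.
Qed.

Lemma OT_exists la zs : valid word0 zs -> run word0 zs = maya la ->
  exists eta, OT la (size zs) eta /\ profile eta = zs.
Proof.
rewrite -maya_empty => /differ_chain_exists ex /ex [s [sz lst prof ch]].
exists (empty_part :: s); split=> //; split=> //=; first by rewrite sz.
  by rewrite -lst -sz; case: (s) => //= x t; rewrite nth_last.
by rewrite -sz.
Qed.

Lemma OT_inj la l la' l' eta eta' : OT la l eta -> OT la' l' eta' ->
  profile eta = profile eta' -> eta = eta'.
Proof.
move=> /OT_cons[s [-> _ _ ch]] /OT_cons[s' [-> _ _ ch']] /= e.
by congr (_ :: _); exact: differ_chain_inj ch ch' e.
Qed.

Lemma tableauE la l eta : OT la l eta -> tableau la (profile eta) = eta.
Proof.
move=> ot; have [sz _ _] := OT_run ot; rewrite /tableau sz.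
case: xgetP => [eta' -> [ot' e]|/(_ eta)]; first exact: OT_inj ot' ot e.
by case.
Qed.

(** Parts decrease weakly, so the rows with i <= part la i form an initial segment and their number
    acts as a threshold. *)
Lemma le_durfee (la : intpart) i : (0 < i)%N ->
  (i <= durfee la)%N = (i <= part la i)%N.
Proof.
move=> i_gt0; rewrite /durfee.
have main n : (n <= size la)%N -> forall j, (0 < j)%N ->
    (j <= count (fun i => i <= part la i) (iota 1 n))%N =
    (j <= part la j)%N && (j <= n)%N.
  elim: n => [|n IH] nla j j_gt0; first by rewrite /= andbC; lia.
  rewrite -[n.+1]addn1 iotaD count_cat /= addn0 add1n.
  have := IH (ltnW nla); set m := count _ _ => {}IH.
  have mn : (m <= n)%N by rewrite /m -[X in (_ <= X)%N](size_iota 1 n) count_size.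
  case: (leqP n.+1 (part la n.+1)) => [n1|n1] /=; last first.
    by rewrite addn0 IH //; have [->|] := eqVneq j n.+1; lia.
  have mE : m = n.
    case: (posnP n) => [n0|n_gt0]; first by lia.
    by have := IH n n_gt0; have := part_mono la (leqnSn n); lia.
  rewrite mE addn1; have [jn|] := leqP j n.+1; last by rewrite andbF.
  by rewrite andbT; have := part_mono la jn; lia.
rewrite main //; have := part_pos la i_gt0; lia.
Qed.

Lemma conj_partE (la : intpart) i j : (0 < i)%N -> (0 < j)%N ->
  (i <= conj_part la j)%N = (j <= part la i)%N.
Proof.
case: i => // i _ j_gt0; rewrite /conj_part /part /=.
have srt : sorted geq (parts la) := proj1 (andP (valP la)).
elim: (parts la) srt i => [_|x s IH /= xs] i.
  by rewrite nth_nil /=; lia.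
have geT : transitive geq by move=> y ? z /= yx zy; exact: leq_trans zy yx.
case: (leqP j x) => jx /=; first by case: i => [|i] //=; rewrite ltnS IH // (path_sorted xs).
have /allP s_le := order_path_min geT xs.
have -> : count (fun y => j <= y)%N s = 0%N.
  apply/eqP; rewrite -leqn0 leqNgt -has_count; apply/hasPn => y /s_le /=.
  by rewrite -ltnNge; move=> yx; exact: leq_ltn_trans yx jx.
case: i => [|i] /=; first by lia.
have [si|is_] := leqP (size s) i; first by rewrite nth_default //; lia.
by have /= := s_le _ (mem_nth 0%N is_); lia.
Qed.

Lemma mem_frob_arms la g : (g \in frob_arms la) = maya la (g%:Z + 1).
Proof.
apply/mapP/mayaP => [[i]|[i i_gt0 e]]; last first.
  exists i; last by lia.
  by rewrite mem_iota add1n ltnS i_gt0 le_durfee //; lia.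
rewrite mem_iota add1n ltnS => /andP[i_gt0]; rewrite le_durfee // => ile ->.
by exists i => //; lia.
Qed.

(** Arms correspond to beads at positive positions, legs to holes at positions up to 0. Together
    they determine the whole word. *)
Lemma mem_frob_legs la d : (d \in frob_legs la) = ~~ maya la (- d%:Z).
Proof.
apply/mapP/idP => [[i]|nd].
  rewrite mem_iota add1n ltnS => /andP[i_gt0]; rewrite le_durfee // => ile ->.
  have ci : (i <= conj_part la i)%N by rewrite conj_partE.
  apply/mayaP => -[k k_gt0 e].
  have := conj_partE la k_gt0 i_gt0; have := leqP k (conj_part la i).
  by case=> kc; lia.
have low j : (0 < j)%N -> (part la j)%:Z - j%:Z + 1 <> - d%:Z.
  by move=> j_gt0 e; case/mayaP: nd; exists j.
(* [k] is the number of beads to the right of the hole at -d. Column k - d then has length k and leg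
   d. *)
have [k kd kmax] : exists2 k, (forall j, (0 < j <= k)%N -> (j <= part la j + d)%N)
    & (part la k.+1 + d < k.+1)%N.
  have ex : exists n, (part la n.+1 + d < n.+1)%N.
    exists (size la + d)%N; have := @part_pos la (size la + d).+1 isT; lia.
  exists (ex_minn ex); case: ex_minnP => // m _ mmin j /andP[j_gt0 jm].
  rewrite leqNgt; apply/negP => lt; have := mmin j.-1.
  by rewrite prednK //; move=> /(_ lt); lia.
have lt1 := low k.+1 isT.
have dk : (d < k)%N by lia.
have lek : (k <= part la k + d)%N by apply: kd; lia.
have ckE : conj_part la (k - d) = k.
  apply/eqP; rewrite eqn_leq conj_partE; [|lia..].
  have := @conj_partE la k.+1 (k - d)%N isT.
  have := @conj_partE la k (k - d)%N; lia.
exists (k - d)%N; last by lia.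
rewrite mem_iota add1n ltnS le_durfee; last by lia.
have := @part_mono la (k - d) k; lia.
Qed.

Lemma frobenius_inj la mu :
  frob_arms la = frob_arms mu -> frob_legs la = frob_legs mu -> la = mu.
Proof.
move=> ea el; apply: maya_inj; apply/funext => p.
have [p0|p0] := lerP p 0.
  have -> : p = - `|p|%N%:Z by lia.
  by apply: negb_inj; rewrite -!mem_frob_legs el.
have -> : p = `|p - 1|%N%:Z + 1 by lia.
by rewrite -!mem_frob_arms ea.
Qed.

Lemma frobeniusK la : frobenius (frob_arms la) (frob_legs la) = la.
Proof.
rewrite /frobenius; case: xgetP => [mu _ [ea el]|/(_ la)].
  exact: frobenius_inj.
by case.
Qed.

Lemma size_frob la :
  (size (frob_arms la) = durfee la) * (size (frob_legs la) = durfee la).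
Proof. by rewrite !size_map size_iota. Qed.

Lemma sorted_frob_arms la : sorted gtn (frob_arms la).
Proof.
apply/(sortedP 0%N) => i; rewrite size_frob => id.
rewrite !(nth_map 0%N) ?size_iota ?nth_iota ?add1n; [|lia..].
have := le_durfee la (ltn0Sn i.+1); have := part_mono la (leqnSn i.+1) => /=; lia.
Qed.

Lemma sorted_frob_legs la : sorted gtn (frob_legs la).
Proof.
apply/(sortedP 0%N) => i; rewrite size_frob => id.
rewrite !(nth_map 0%N) ?size_iota ?nth_iota ?add1n; [|lia..].
have := le_durfee la (ltn0Sn i.+1).
have := @conj_partE la i.+2 i.+2 isT isT.
have := @conj_partE la (conj_part la i.+2) i.+2; have := @conj_partE la (conj_part la i.+2) i.+1.
rewrite /= ; lia.
Qed.

Lemma part_rect_compl a b la i : (0 < i)%N ->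
  part (rect_compl a b la) i = (if i <= a then b - part la (a.+1 - i) else 0)%N.
Proof.
case: i => // i _; rewrite /part /=.
have nth_s j : nth 0%N [seq (b - part la i)%N | i <- rev (iota 1 a)] j =
    (if j < a then b - part la (a - j) else 0)%N.
  case: (ltnP j a) => ja; last by rewrite nth_default ?size_map ?size_rev ?size_iota.
  rewrite (nth_map 0%N) ?size_rev ?size_iota // nth_rev ?size_iota // nth_iota; last by lia.
  by congr (_ - part _ _)%N; lia.
rewrite nth_filter_pos ?nth_s ?subSS //.
apply/(sortedP 0%N) => j; rewrite size_map size_rev size_iota => ja.
rewrite !nth_s ja (ltnW ja) /=; apply: leq_sub2l; apply: part_mono; lia.
Qed.

Section Complement.
Variables (a b : nat) (la : intpart).
Hypotheses (la_a : (size la <= a)%N) (la_b : (part la 1 <= b)%N).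

Let part_le_b i : (part la i <= b)%N.
Proof.
case: i => [|i]; first exact: la_b.
by apply: leq_trans la_b; exact: part_mono.
Qed.

Let part_out i : (a < i)%N -> part la i = 0%N.
Proof. by move=> ai; have := @part_pos la i; lia. Qed.

(** The complement is turned by 180 degrees: row i becomes row a + 1 - i, which reflects the word
    inside the window (-a, b] without exchanging the two letters. *)
Lemma maya_rect_compl p : - a%:Z < p -> p <= b%:Z ->
  maya (rect_compl a b la) (b%:Z - a%:Z + 1 - p) = maya la p.
Proof.
move=> ap pb; apply/mayaP/mayaP => -[i i_gt0 e].
  move: e; rewrite part_rect_compl //; case: ifP => ia e; last by lia.
  by exists (a.+1 - i)%N; have := part_le_b (a.+1 - i); lia.
have ia : (i <= a)%N by have := @part_out i; lia.
exists (a.+1 - i)%N; first by lia.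
rewrite part_rect_compl; last by lia.
rewrite ifT; last by lia.
rewrite (_ : (a.+1 - (a.+1 - i) = i)%N); last by lia.
by have := part_le_b i; lia.
Qed.

Lemma rect_complK : rect_compl a b (rect_compl a b la) = la.
Proof.
apply: part_inj => i i_gt0; rewrite part_rect_compl //.
case: ifP => ia; last by rewrite part_out //; lia.
rewrite part_rect_compl; last by lia.
rewrite ifT; last by lia.
rewrite (_ : (a.+1 - (a.+1 - i) = i)%N); last by lia.
by have := part_le_b i; lia.
Qed.

Let arms_lt g : g \in frob_arms (rect_compl a b la) -> (g < b)%N.
Proof.
rewrite mem_frob_arms => /mayaP[i i_gt0].
by rewrite part_rect_compl //; case: ifP => _; lia.
Qed.

Let legs_lt d : d \in frob_legs (rect_compl a b la) -> (d < a)%N.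
Proof.
rewrite mem_frob_legs => nd; rewrite ltnNge; apply/negP => ad; case/mayaP: nd.
by exists d.+1; rewrite // part_rect_compl // ifF; lia.
Qed.

Lemma mem_beta_of y :
  (y \in beta_of a b la) = (1 <= y <= b)%N && maya la (y%:Z - a%:Z).
Proof.
apply/mapP/andP => [[g gin ->]|[yb my]].
  have gb := arms_lt gin; split; first by lia.
  move: gin; rewrite mem_frob_arms -maya_rect_compl; [|lia..].
  by rewrite (_ : _ - (_ - _) = g%:Z + 1) //; lia.
exists (b - y)%N; last by lia.
rewrite mem_frob_arms (_ : _ + 1 = b%:Z - a%:Z + 1 - (y%:Z - a%:Z)); last by lia.
by rewrite maya_rect_compl //; lia.
Qed.

Lemma mem_alpha_of x :
  (x \in alpha_of a b la) = (1 <= x <= a)%N && ~~ maya la (b%:Z + 1 - x%:Z).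
Proof.
apply/mapP/andP => [[d din ->]|[xa mx]].
  have da := legs_lt din; split; first by lia.
  move: din; rewrite mem_frob_legs -maya_rect_compl; [|lia..].
  by rewrite (_ : _ - (_ - _) = - d%:Z) //; lia.
exists (a - x)%N; last by lia.
rewrite mem_frob_legs (_ : - _ = b%:Z - a%:Z + 1 - (b%:Z + 1 - x%:Z)); last by lia.
by rewrite maya_rect_compl //; lia.
Qed.

Lemma cols_beta_of : cols b (beta_of a b la).
Proof.
apply/andP; split; last first.
  by apply/allP => y; rewrite mem_beta_of => /andP[].
have /allP lt := arms_lt.
apply: (homo_sorted_in _ lt (sorted_frob_arms _)) => g g' /=.
by rewrite !unfold_in /=; lia.
Qed.

Lemma cols_alpha_of : cols a (alpha_of a b la).
Proof.
apply/andP; split; last first.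
  by apply/allP => x; rewrite mem_alpha_of => /andP[].
have /allP lt := legs_lt.
apply: (homo_sorted_in _ lt (sorted_frob_legs _)) => g g' /=.
by rewrite !unfold_in /=; lia.
Qed.

Lemma size_alpha_beta_of : size (alpha_of a b la) = size (beta_of a b la).
Proof. by rewrite !size_map. Qed.

Lemma lambda_ofK : lambda_of a b (alpha_of a b la) (beta_of a b la) = la.
Proof.
have arms : [seq (b - y)%N | y <- beta_of a b la] = frob_arms (rect_compl a b la).
  by rewrite -map_comp; apply: map_id_in => g /arms_lt /= gb; lia.
have legs : [seq (a - x)%N | x <- alpha_of a b la] = frob_legs (rect_compl a b la).
  by rewrite -map_comp; apply: map_id_in => d /legs_lt /= da; lia.
rewrite /lambda_of arms legs frobeniusK; exact: rect_complK.
Qed.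

(** Here partitions meet paths: the complement in the definition of [lambda_of] is what turns the
    word along the bottom and right sides into the Maya word of [la] itself. *)
Lemma maya_boundary_word :
  maya la = boundary_word a b (alpha_of a b la) (beta_of a b la).
Proof.
apply/boundary_wordP; split.
- move=> p pa; apply/mayaP; exists `|1 - p|%N; first by lia.
  by rewrite part_out; lia.
- by move=> j jb; rewrite mem_beta_of jb.
- by move=> x xa; rewrite mem_alpha_of xa negbK.
- move=> p bp; apply/negP => /mayaP[i i_gt0 e].
  by have := part_le_b i; lia.
Qed.

End Complement.

(** * The ordering pairs (L_q, prec_q) *)

(** L_q and content form a coordinate system of the integer lattice, with inverse [Gq]; hence [Phi]
    loses nothing but the order of the points. *)
Lemma GqK q p : Gq q (Lq q p) (content p) = p.
Proof.
case: p => i j; rewrite /Gq /Lq /content /=.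
by case: (lerP q 0) => q0; repeat case: ifP => ?; congr (_, _); lia.
Qed.

Lemma Lq_Gq q u z : Lq q (Gq q u z) = u.
Proof.
rewrite /Gq /Lq; case: (lerP q 0) => q0; repeat case: ifP => ? /=; lia.
Qed.

Lemma content_Gq q u z : content (Gq q u z) = z.
Proof. by rewrite /Gq /content; repeat case: ifP => ? /=; lia. Qed.

(** For u >= 1, the points with positive coordinates and L_q at most u fill a rectangle with
    [last_row] rows and [last_col] columns. At u = n these are the dimensions [dim_a] and
    [dim_b]. *)
Definition last_row (q u : int) : int := Num.max u (u - q).
Definition last_col (q u : int) : int := Num.max u (u + q).

Lemma Gq_rect n q u z : 1 <= u <= n%:Z ->
  1 - last_row q u <= z <= last_col q u - 1 ->
  Gq q u z \in rect (dim_a n q) (dim_b n q).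
Proof.
rewrite mem_rect /dim_a /dim_b /last_row /last_col /Gq => un zb.
by case: (lerP q 0) => q0; repeat case: ifP => ? /=; lia.
Qed.

Lemma Lq_rect n q p : p \in rect (dim_a n q) (dim_b n q) -> 1 <= Lq q p <= n%:Z.
Proof.
by rewrite mem_rect /dim_a /dim_b /Lq; case: (lerP q 0) => q0; lia.
Qed.

Lemma Lq_le_dim n q (i j : nat) : (0 < n)%N ->
  (Lq q (i%:Z, j%:Z) <= n%:Z) = (i <= dim_a n q)%N && (j <= dim_b n q)%N.
Proof.
by rewrite /dim_a /dim_b /Lq /=; case: (lerP q 0) => q0; lia.
Qed.

Section Order.
Variables (q : int) (prec : rel int).
Hypothesis q_prec : q_order q prec.

Let key p := (Lq q p, content p).
Let ltk (p p' : lpoint) := lex_prec prec (key p) (key p').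

Lemma lex_irr : irreflexive (lex_prec prec).
Proof. by case: q_prec => -[irr _ _] _ _ x; rewrite /lex_prec ltxx eqxx irr. Qed.

Lemma lex_trans : transitive (lex_prec prec).
Proof.
case: q_prec => -[_ tr _] _ _ [y1 y2] [x1 x2] [z1 z2]; rewrite /lex_prec /=.
case/orP => [xy|/andP[/eqP -> xy]]; case/orP => [yz|/andP[/eqP <- yz]].
- by rewrite (lt_trans xy yz).
- by rewrite xy.
- by rewrite yz.
by rewrite eqxx (tr _ _ _ xy yz) orbT.
Qed.

Lemma lex_total x y : x != y -> lex_prec prec x y || lex_prec prec y x.
Proof.
case: q_prec x y => -[_ _ tot] _ _ [x1 x2] [y1 y2]; rewrite /lex_prec xpair_eqE /=.
by case: ltgtP => //= _ /tot.
Qed.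

Lemma key_inj : injective key.
Proof. by move=> p p' [e1 e2]; rewrite -(GqK q p) e1 e2 GqK. Qed.

(** Level sets of L_q are nested hooks with corners of content q, and a q-order runs through each
    arm towards the corner, so no later point is below an earlier one in the product order. *)
Lemma ltk_before p p' : ltk p p' -> before p p'.
Proof.
case: q_prec => -[irr tr tot] up down.
case: p p' => [i j] [i' j'] lt; apply: contraT; rewrite /before /= => nb.
move: lt; rewrite /ltk /lex_prec /key /=.
case/orP => [|/andP[/eqP e pr]]; first by rewrite /Lq; case: (lerP q 0) => /= ?; lia.
have [zz|zz|zz] := ltgtP (content (i, j)) (content (i', j')).
- have /down : content (i', j') > content (i, j) by [].
  move/(_ _); rewrite /content /= in zz *; move: e; rewrite /Lq /content /= => e H.
  have : prec (j' - i') (j - i) by apply: H; case: (lerP q 0) e => ? /=; lia.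
  by move=> pr'; have := tr _ _ _ pr pr'; rewrite irr.
- have /up : content (i', j') < content (i, j) by [].
  move/(_ _); rewrite /content /= in zz *; move: e; rewrite /Lq /content /= => e H.
  have : prec (j' - i') (j - i) by apply: H; case: (lerP q 0) e => ? /=; lia.
  by move=> pr'; have := tr _ _ _ pr pr'; rewrite irr.
- by rewrite zz irr in pr.
Qed.

Lemma is_progressionE S s : is_progression (Lq q) prec S s <->
  [/\ uniq s, s =i S & sorted ltk s].
Proof. by rewrite /is_progression sorted_map. Qed.

Lemma progression_unique S s s' : is_progression (Lq q) prec S s ->
  is_progression (Lq q) prec S s' -> s = s'.
Proof.
move=> /is_progressionE[_ sS srt] /is_progressionE[_ sS' srt'].
apply: (irr_sorted_eq (leT := ltk)) => //.
- by move=> y x z; exact: lex_trans.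
- by move=> x; exact: lex_irr.
by move=> x; rewrite sS sS'.
Qed.

Lemma progressionE S s : is_progression (Lq q) prec S s ->
  progression (Lq q) prec S = s.
Proof.
move=> ps; rewrite /progression; case: xgetP => [s' -> ps'|/(_ s)//].
exact: progression_unique ps' ps.
Qed.

Lemma progressionP S : is_progression (Lq q) prec S (progression (Lq q) prec S).
Proof.
suff [s ps] : exists s, is_progression (Lq q) prec S s by rewrite (progressionE ps).
(* Sorting is done with a total, reflexive relation; strictness returns because distinct points have
   distinct keys. *)
pose leT p p' := ~~ ltk p' p.
have tot : total leT.
  move=> p p'; rewrite /leT -negb_and; apply/negP => /andP[h1 h2].
  by have := lex_trans h1 h2; rewrite lex_irr.
have us : uniq (sort leT (enum_fset S)) by rewrite sort_uniq fset_uniq.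
exists (sort leT (enum_fset S)); apply/is_progressionE; split=> //.
  by move=> p; rewrite mem_sort.
have /(sortedP (0 : lpoint)) srt := sort_sorted tot (enum_fset S).
apply/(sortedP (0 : lpoint)) => i isz; have := srt i isz; rewrite /leT.
set x := nth _ _ i; set y := nth _ _ i.+1 => nyx.
have xy : x != y by rewrite /x /y nth_uniq ?(ltnW isz) ?neq_ltn ?ltnSn.
have /lex_total : key x != key y by apply: contra xy => /eqP /key_inj ->.
by rewrite -/(ltk _ _) -/(ltk _ _) (negPf nyx) orbF.
Qed.

Lemma progression_pairwise S s : is_progression (Lq q) prec S s -> pairwise before s.
Proof.
move=> /is_progressionE[_ _]; rewrite sorted_pairwise; last first.
  by move=> y x z; exact: lex_trans.
by apply: sub_pairwise; exact: ltk_before.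
Qed.

(* The word is that of the empty partition outside the window
   (- last_row u, last_col u]; at level u, its letters at the two ends of the
   window can change only from the step with content next to that end on, and
   in a q-order no later step of that level lies beyond this end. *)
Definition level_inv (u z : int) (w : int -> bool) : Prop :=
  [/\ forall p : int, last_col q u < p -> w p = false,
      forall p : int, p <= - last_row q u -> w p = true,
      w (last_col q u) -> [\/ u <= 0, z = last_col q u - 1 |
        prec (last_col q u - 1) z] &
      ~~ w (1 - last_row q u) -> [\/ u <= 0, z = 1 - last_row q u |
        prec (1 - last_row q u) z]].

(** For a level of at least 1, these are the contents of the points of the hook that have positive
    coordinates. *)
Definition in_window (uz : int * int) : bool :=
  1 - last_row q uz.1 <= uz.2 <= last_col q uz.1 - 1.

(** Let C be the right end of the new window. A swap at z' >= C exchanges distinct letters only if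
    z' = C and the letter at C is 1. By the invariant this letter was set on the same level by the
    step C - 1, so C - 1 precedes z' = C, while a q-order puts C before C - 1. The left end is
    symmetric. *)
Lemma level_inv_step u z u' z' w : level_inv u z w ->
  lex_prec prec (u, z) (u', z') -> 1 <= u' -> w z' != w (z' + 1) ->
  in_window (u', z') /\ level_inv u' z' (swapw z' w).
Proof.
case: q_prec => -[irr tr _] up down [hi lo hi1 lo1] lex u'1 neq.
have monoc v v' : v < v' -> last_col q v + 1 <= last_col q v'.
  by rewrite /last_col; clear; lia.
have monor v v' : v < v' -> last_row q v + 1 <= last_row q v'.
  by rewrite /last_row; clear; lia.
have qc : q <= last_col q u' - 1 by rewrite /last_col; clear -u'1; lia.
have qr : 1 - last_row q u' <= q by rewrite /last_row; clear -u'1; lia.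
have hi' : last_col q u <= last_col q u'.
  by move: lex; rewrite /lex_prec /= => /orP[/monoc|/andP[/eqP ->]]; lia.
have lo' : last_row q u <= last_row q u'.
  by move: lex; rewrite /lex_prec /= => /orP[/monor|/andP[/eqP ->]]; lia.
have no_loop x y : prec x y -> prec y x -> False.
  by move=> xy yx; have := tr _ _ _ xy yx; rewrite irr.
have w_hi : w (last_col q u') -> u = u' /\ prec z z' /\
    (z = last_col q u' - 1 \/ prec (last_col q u' - 1) z).
  move=> wc; move: lex; rewrite /lex_prec /= => /orP[uu|/andP[/eqP uu zz]].
    by move: wc; rewrite hi //; have := monoc _ _ uu; clear; lia.
  subst u'; split=> //; split=> //.
  by case: (hi1 wc) => [|->|]; [clear -u'1; lia|left|right].
have w_lo : ~~ w (1 - last_row q u') -> u = u' /\ prec z z' /\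
    (z = 1 - last_row q u' \/ prec (1 - last_row q u') z).
  move=> wr; move: lex; rewrite /lex_prec /= => /orP[uu|/andP[/eqP uu zz]].
    by move: wr; rewrite lo //; have := monor _ _ uu; clear; lia.
  subst u'; split=> //; split=> //.
  by case: (lo1 wr) => [|->|]; [clear -u'1; lia|left|right].
have zhi : z' <= last_col q u' - 1.
  rewrite leNgt; apply/negP => lt.
  have w1 : w (z' + 1) = false by apply: hi; clear -lt hi'; lia.
  have wz : w z' by move: neq; rewrite w1; case: (w z').
  have [zc|zc] := lerP z' (last_col q u'); last first.
    by move: wz; rewrite hi //; clear -zc hi'; lia.
  have zE : z' = last_col q u' by clear -zc lt; lia.
  (* This closes a cycle: z' - 1 equals z or precedes it, and z precedes z'. *)
  have down1 : prec z' (z' - 1) by apply: down; rewrite ?zE //; clear; lia.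
  have [_ [zz' []]] : _ := w_hi ltac:(by rewrite -zE).
    by rewrite -zE => zz1; apply: no_loop down1; rewrite -zz1.
  by rewrite -zE => /tr /(_ zz') /no_loop; apply.
have zlo : 1 - last_row q u' <= z'.
  rewrite leNgt; apply/negP => lt.
  have w1 : w z' by apply: lo; clear -lt lo'; lia.
  have wz : ~~ w (z' + 1) by move: neq; rewrite w1; case: (w (z' + 1)).
  have [zc|zc] := lerP (- last_row q u') z'; last first.
    by move: wz; rewrite lo //; clear -zc lo'; lia.
  have zE : 1 - last_row q u' = z' + 1 by clear -zc lt; lia.
  have up1 : prec z' (z' + 1) by apply: up; rewrite -?zE //; clear -lt; lia.
  have [_ [zz' []]] : _ := w_lo ltac:(by rewrite zE).
    by rewrite zE => zz1; apply: no_loop up1; rewrite -zz1.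
  by rewrite zE => /tr /(_ zz') /no_loop; apply.
have out p : p != z' -> p != z' + 1 -> swapw z' w p = w p.
  by rewrite /swapw => /negPf -> /negPf ->.
split; first by rewrite /in_window /= zlo zhi.
split.
- by move=> p pc; rewrite out ?hi //; clear -pc zhi hi'; lia.
- by move=> p pr; rewrite out ?lo //; clear -pr zlo lo'; lia.
- have [->|zc] := eqVneq z' (last_col q u' - 1); first by constructor 2.
  rewrite out; [|clear -zhi zc; lia..] => /w_hi [_ [zz' [<-|h]]].
    by constructor 3.
  by constructor 3; exact: tr h zz'.
- have [->|zc] := eqVneq z' (1 - last_row q u'); first by constructor 2.
  rewrite out; [|clear -zlo zc; lia..] => /w_lo [_ [zz' [<-|h]]].
    by constructor 3.
  by constructor 3; exact: tr h zz'.
Qed.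

Lemma level_inv_path (uzs : seq (int * int)) u z w : level_inv u z w ->
  path (lex_prec prec) (u, z) uzs -> all (fun uz => 1 <= uz.1) uzs ->
  valid w (unzip2 uzs) -> all in_window uzs.
Proof.
elim: uzs u z w => //= -[u' z'] uzs IH u z w inv /= /andP[lex pth].
move=> /andP[u1 all1] /andP[neq val].
have [-> inv'] := level_inv_step inv lex u1 neq.
exact: IH inv' pth all1 val.
Qed.

Lemma sorted_in_window (uzs : seq (int * int)) :
  sorted (lex_prec prec) uzs -> all (fun uz => 1 <= uz.1) uzs ->
  valid word0 (unzip2 uzs) -> all in_window uzs.
Proof.
(* A fictitious visit (0, 0) is put in front: it satisfies the invariant through the alternative u
   <= 0, and every level from 1 on comes after it. *)
move=> srt all1; apply: (@level_inv_path uzs 0 0) => //.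
  split; [| |by constructor 1..]; rewrite /word0 /last_col /last_row => p; lia.
case: uzs srt all1 => //= -[u z] uzs /= -> /andP[/= u1 _].
by rewrite /lex_prec /= andbT; apply/orP; left; lia.
Qed.

End Order.

(** * The bijection *)

Lemma rect_uniq a b : uniq (rect a b).
Proof.
by apply: allpairs_uniq; rewrite ?iota_uniq // => -[i j] [i' j'] _ _ [-> ->].
Qed.

Lemma rect_pairwise a b : pairwise before (rect a b).
Proof.
elim: a => [//|a IH]; rewrite /rect (_ : iota 1 a.+1 = iota 1 a ++ [:: a.+1]).
  rewrite allpairs_cat /= cats0 pairwise_cat; apply/and3P; split; [|exact: IH|].
    apply/allrelP => p p'; rewrite mem_rect => pr /mapP[j _ ->].
    by rewrite /before /=; move: pr; clear; lia.
  rewrite pairwise_map.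
  have := iota_ltn_sorted 1 b; rewrite sorted_pairwise; last exact: ltn_trans.
  by apply: sub_pairwise => i j; rewrite /before /= ltxx.
by rewrite -(addn1 a) iotaD /= add1n addn1.
Qed.

Lemma progression_contents a b (S : {fset lpoint}) (s : seq lpoint) w :
  {subset S <= rect a b} -> uniq s -> s =i S -> pairwise before s ->
  (valid w [seq content p | p <- s] = valid w (contents a b (mem S))) *
  (run w [seq content p | p <- s] = run w (contents a b (mem S))).
Proof.
move=> sub us sS pw; apply: linear_extension => //.
  apply: uniq_perm => //; first by rewrite filter_uniq ?rect_uniq.
  move=> p; rewrite mem_filter sS /=; case: (boolP (p \in S)) => // /sub ->.
  by [].
exact: pairwise_filter (rect_pairwise a b).
Qed.

(** The paths disappear: membership becomes a condition on words alone, of the same kind as the one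
    that governs oscillating tableaux. *)
Lemma VOSP a b al be l (S : {fset lpoint}) :
  cols a al -> cols b be -> size al = size be ->
  VOS a b al be l S <-> [/\ {subset S <= rect a b}, #|` S| = l,
    valid word0 (contents a b (mem S)) &
    run word0 (contents a b (mem S)) = boundary_word a b al be].
Proof.
move=> Cal Cbe sz; have mem_vos P p :
    (p \in vos a b P) = (p \in rect a b) && (vacancy P p || osculation P p).
  by rewrite !inE.
split=> [[P [PO cardS] <-]|[sub cardS val runS]].
  have [|val runP] := OP_run (Z := mem (vos a b P)) Cal Cbe sz PO.
    by move=> p pr; rewrite /= mem_vos pr.
  by split=> // p; rewrite mem_vos => /andP[].
have [P [PO ZP]] := OP_of_run Cal Cbe sz val runS.
have SE : vos a b P = S.
  apply/fsetP => p; rewrite mem_vos; apply/andP/idP => [[pr]|pS].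
    by rewrite -ZP.
  by have pr := sub _ pS; rewrite -ZP.
by exists P => //; split=> //; rewrite SE.
Qed.

Lemma mem_Phi q te p :
  (p \in Phi q te) =
  (p \in [seq Gq q uz.1 uz.2 | uz <- zip te.1 (profile te.2)]).
Proof. by rewrite inE. Qed.

Lemma GOT_in_window n q prec la l te : q_order q prec ->
  GOT (pos_upto n) prec la l te ->
  {in zip te.1 (profile te.2), forall uz,
    (1 <= uz.1 <= n%:Z) && in_window q uz}.
Proof.
case: te => t eta qp [/= sz tn ot srt]; have [szp val _] := OT_run ot.
have t1 : {in zip t (profile eta), forall uz, 1 <= uz.1 <= n%:Z}.
  by move=> uz /(map_f fst); rewrite -/(unzip1 _) unzip1_zip ?sz ?szp // => /tn.
have /allP win : all (in_window q) (zip t (profile eta)).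
  apply: (sorted_in_window qp srt); last by rewrite unzip2_zip ?sz ?szp.
  by apply/allP => uz /t1 /andP[].
by move=> uz uzin; rewrite t1 // win.
Qed.

Lemma last_row_le n q u : u <= n%:Z -> last_row q u <= (dim_a n q)%:Z.
Proof. by rewrite /last_row /dim_a; clear; lia. Qed.

Lemma last_col_le n q u : u <= n%:Z -> last_col q u <= (dim_b n q)%:Z.
Proof. by rewrite /last_col /dim_b; clear; lia. Qed.

(** All contents lie in the window of the rectangle, so [maya la] agrees with [word0] outside (-a,
    b]; too many rows or too long a first row would contradict this. *)
Lemma GOT_shape n q prec la l te : (0 < n)%N -> q_order q prec ->
  GOT (pos_upto n) prec la l te ->
  Lq q ((size la)%:Z, (part la 1)%:Z) <= n%:Z.
Proof.
move=> n_gt0 qp got; have win := GOT_in_window qp got.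
case: got => sz _ ot _; have [szp _ runE] := OT_run ot.
have out p : (p <= - (dim_a n q)%:Z) || ((dim_b n q)%:Z < p) -> maya la p = word0 p.
  move=> pout; rewrite -runE run_out // => z.
  rewrite -(@unzip2_zip _ _ te.1 (profile te.2)) ?sz ?szp // => /mapP[[u z0] /win].
  rewrite /in_window /= => /andP[/andP[_ un] /andP[z1 z2]] -> {z}.
  have := last_row_le q un; have := last_col_le q un.
  by move: pout z1 z2; clear; lia.
rewrite Lq_le_dim //; apply/andP; split; rewrite leqNgt; apply/negP => lt.
  have s0 : (0 < size la)%N by clear -lt; lia.
  (* Position 1 - size is always a hole: the last nonzero row has its bead to the right of it, the
     zero rows have theirs to the left. *)
  have : maya la (1 - (size la)%:Z) by rewrite out /word0; clear -lt s0; lia.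
  case/mayaP => i i_gt0 e; have := part_pos la i_gt0.
  have := @part_mono la i (size la); have := part_pos la s0.
  by clear -e i_gt0 s0; lia.
have := out (part la 1)%:Z; rewrite /word0.
have -> : maya la (part la 1)%:Z by apply/mayaP; exists 1%N => //; clear; lia.
by move=> /(_ ltac:(clear -lt; lia)); clear -lt; lia.
Qed.

Section Bijection.
Variables (n : nat) (q : int) (prec : rel int) (la : intpart) (l : nat).
Hypotheses (n_gt0 : (0 < n)%N) (q_prec : q_order q prec).
Hypothesis Lq_le : Lq q ((size la)%:Z, (part la 1)%:Z) <= n%:Z.

Let a := dim_a n q.
Let b := dim_b n q.
Let al := alpha_of a b la.
Let be := beta_of a b la.

Let la_a : (size la <= a)%N.
Proof. by move: Lq_le; rewrite Lq_le_dim // => /andP[]. Qed.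

Let la_b : (part la 1 <= b)%N.
Proof. by move: Lq_le; rewrite Lq_le_dim // => /andP[]. Qed.

Let VOS_laP S : VOS a b al be l S <-> [/\ {subset S <= rect a b}, #|` S| = l,
  valid word0 (contents a b (mem S)) &
  run word0 (contents a b (mem S)) = maya la].
Proof.
rewrite (maya_boundary_word la_a la_b); apply: VOSP.
- exact: cols_alpha_of.
- exact: cols_beta_of.
- exact: size_alpha_beta_of.
Qed.

Lemma Theta_VOS S : VOS a b al be l S ->
  GOT (pos_upto n) prec la l (Theta (Lq q) prec a b al be S) /\
  Phi q (Theta (Lq q) prec a b al be S) = S.
Proof.
case/VOS_laP => sub cardS val runS.
rewrite /Theta lambda_ofK //; set s := progression _ _ _.
have ps : is_progression (Lq q) prec S s := progressionP q_prec S.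
have [us sS srt] := ps.
have szs : size s = l.
  by rewrite -cardS; apply: perm_size; apply: uniq_perm; rewrite ?fset_uniq.
have [] := progression_contents word0 sub us sS (progression_pairwise q_prec ps).
rewrite val runS => val' run'.
have [eta [ot prof]] := OT_exists val' run'; rewrite size_map szs in ot.
rewrite -prof (tableauE ot).
have zipE : zip [seq Lq q p | p <- s] (profile eta) =
    [seq (Lq q p, content p) | p <- s].
  by rewrite prof zip_map.
split; last first.
  apply/fsetP => p; rewrite mem_Phi /= zipE -map_comp -sS.
  by rewrite (eq_map (g := id)) ?map_id // => x; rewrite /= GqK.
split=> /=; rewrite ?size_map ?zipE //.
move=> u /mapP[p]; rewrite sS => /sub pr ->.
exact: Lq_rect pr.
Qed.

Lemma Phi_GOT te : GOT (pos_upto n) prec la l te ->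
  VOS a b al be l (Phi q te) /\ Theta (Lq q) prec a b al be (Phi q te) = te.
Proof.
move=> got; have win := GOT_in_window q_prec got.
case: te got win => t eta [/= sz tn ot srt] win; have [szp val runE] := OT_run ot.
set s := [seq Gq q uz.1 uz.2 | uz <- zip t (profile eta)].
have sS : s =i Phi q (t, eta) by move=> p; rewrite mem_Phi.
have keys : [seq (Lq q p, content p) | p <- s] = zip t (profile eta).
  rewrite -map_comp (eq_map (g := id)) ?map_id // => -[u z] /=.
  by rewrite Lq_Gq content_Gq.
have Ls : [seq Lq q p | p <- s] = t.
  rewrite -[RHS](@unzip1_zip _ _ t (profile eta)) ?sz ?szp // -keys.
  by rewrite /unzip1 -map_comp.
have cs : [seq content p | p <- s] = profile eta.
  rewrite -[RHS](@unzip2_zip _ _ t (profile eta)) ?sz ?szp // -keys.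
  by rewrite /unzip2 -map_comp.
(* Strictly increasing keys make the points distinct, so that [Phi] has exactly l elements and [s]
   is their progression. *)
have us : uniq s.
  apply: (@map_uniq _ _ (fun p => (Lq q p, content p))); rewrite keys.
  exact: sorted_uniq (lex_trans q_prec) (lex_irr q_prec) _ srt.
have ps : is_progression (Lq q) prec (Phi q (t, eta)) s by split; rewrite ?keys.
have sub : {subset Phi q (t, eta) <= rect a b}.
  move=> p; rewrite -sS => /mapP[uz /win/andP[un zw] ->].
  exact: Gq_rect un zw.
have [] := progression_contents word0 sub us sS (progression_pairwise q_prec ps).
rewrite cs val runE => val' run'; split.
  apply/VOS_laP; split=> //.
  rewrite -szp -cs size_map; apply: perm_size; apply: uniq_perm => //.
by rewrite /Theta (progressionE q_prec ps) Ls cs lambda_ofK // (tableauE ot).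
Qed.

End Bijection.

Theorem theorem15 (n : nat) (q : int) (prec : rel int) (la : intpart)
    (l : nat) (n_gt0 : (0 < n)%N) (q_prec : q_order q prec) :
  (n%:Z < Lq q ((size la)%:Z, (part la 1)%:Z) ->
     GOT (pos_upto n) prec la l = set0) /\
  (Lq q ((size la)%:Z, (part la 1)%:Z) <= n%:Z ->
     let a := dim_a n q in
     let b := dim_b n q in
     let alpha := alpha_of a b la in
     let beta := beta_of a b la in
     [/\ set_bij (GOT (pos_upto n) prec la l) (VOS a b alpha beta l) (Phi q),
         {in VOS a b alpha beta l,
            cancel (Theta (Lq q) prec a b alpha beta) (Phi q)} &
         {in GOT (pos_upto n) prec la l,
            cancel (Phi q) (Theta (Lq q) prec a b alpha beta)}]).
Proof.
split=> [lt|le a b alpha beta].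
  apply/seteqP; split=> // te /(GOT_shape n_gt0 q_prec).
  by rewrite leNgt lt.
have toV te (got : GOT (pos_upto n) prec la l te) := Phi_GOT n_gt0 q_prec le got.
have toG S (vosS : VOS a b alpha beta l S) := Theta_VOS n_gt0 q_prec le vosS.
split.
- split.
  + by move=> te /toV[].
  + by move=> te te' /set_mem/toV[_ e] /set_mem/toV[_ e'] ee; rewrite -e -e' ee.
  + by move=> S /toG[got e]; exists (Theta (Lq q) prec a b alpha beta S).
- by move=> S /set_mem/toG[].
- by move=> te /set_mem/toV[].
Qed.
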